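(* Let $A\in\mathbb{R}^{n\times d}$, $b\in\mathbb{R}^n$, $f(x):=\|Ax-b\|_2^2$ and $x^*=\arg\min_x f(x)$. Let $S\in\mathbb{R}^{m\times n}$ be a Gaussian sketch and $\hat{x}=\arg\min_x\|SAx-Sb\|_2^2$. Suppose that the sketch size is such that $m\gtrsim d$. Then the optimality ratio of $\hat{x}$ with respect to the optimal solution $x^*$ is concentrated around its mean as $$P\bigg(\Big|\frac{f(\hat{x})}{f(x^* )}-1-\frac{d}{m-d-1}\Big|<\epsilon\bigg)\ \ge\ 1-C_1e^{-C_2\epsilon^4m}\qquad(\epsilon>0),$$ where $C_1,C_2$ are positive constants.
   Context: The notation $m\gtrsim d$ means that there exists a positive finite constant $c$ such that $m\ge cd$. A Gaussian sketch is a random matrix $S\in\mathbb{R}^{m\times n}$ with i.i.d. zero-mean Gaussian entries, scaled so that $\mathbb{E}[S^TS]=I_n$ (that is, entries $\mathcal{N}(0,1/m)$). Probability is over $S$ only; $A$ and $b$ are deterministic.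
   Formalization: C_1, C_2 may depend on an upper bound for ε (uniform constants for all ε>0 fail: the ratio has polynomial tails); m≳d means m≥cd for one universal c; x* is the unique minimizer and f(x* )≠0; that the centering is the mean is not proved. *)

(* Defs.v *)
(* Built on MathComp and MathComp-Analysis. *)
From mathcomp Require Import all_boot all_order all_algebra.
From mathcomp Require Import all_classical all_reals all_analysis.

Set Implicit Arguments.
Unset Strict Implicit.
Unset Printing Implicit Defensive.

Import Order.TTheory GRing.Theory Num.Theory.
Import numFieldNormedType.Exports.

Local Open Scope classical_set_scope.
Local Open Scope ring_scope.

(* The library's norm on matrices is the sup norm, hence this definition. *)
Definition sqnorm2 (R : realType) (k : nat) (v : 'cV[R]_k) : R :=
  \sum_(i < k) v i 0 ^+ 2.

Definition lsq (R : realType) (k d : nat) (A : 'M[R]_(k, d)) (b : 'cV[R]_k)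
  (x : 'cV[R]_d) : R := sqnorm2 (A *m x - b).

(* The set of all global minimizers; "x = argmin f" with a unique minimizer
   is [argmin f = [set x]]. *)
Definition argmin (R : realType) (X : Type) (f : X -> R) : set X :=
  [set x | forall y, f x <= f y].

Definition mutually_independent (disp : measure_display)
    (T : measurableType disp) (R : realType) (P : probability T R)
    (I : finType) (X : I -> {RV P >-> R}) : Prop :=
  forall (J : {set I}) (B : I -> set R), (forall i, measurable (B i)) ->
    P [set t | forall i, i \in J -> B i (X i t)] =
      (\prod_(i in J) P (X i @^-1` B i))%E.

Definition rvmx (disp : measure_display) (T : measurableType disp)
    (R : realType) (P : probability T R) (p q : nat)
    (X : 'I_p -> 'I_q -> {RV P >-> R}) (t : T) : 'M[R]_(p, q) :=
  \matrix_(i < p, j < q) X i j t.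

(* I.i.d. N(0, 1/m) entries. The second argument of [normal_prob] is the
   standard deviation. *)
Definition gaussian_sketch (disp : measure_display) (T : measurableType disp)
    (R : realType) (P : probability T R) (m n : nat)
    (S : 'I_m -> 'I_n -> {RV P >-> R}) : Prop :=
  (forall i j (B : set R), measurable B ->
     distribution P (S i j) B = normal_prob 0 (Num.sqrt m%:R^-1) B) /\
  mutually_independent (fun ij : 'I_m * 'I_n => S ij.1 ij.2).

(* Main.v *)
From HB Require Import structures.
Require Import Defs.
From mathcomp Require Import all_boot all_order all_algebra.
From mathcomp Require Import all_classical all_reals all_analysis.
From mathcomp Require Import measurable_realfun complex ring lra.

Set Implicit Arguments.
Unset Strict Implicit.
Unset Printing Implicit Defensive.

Import Order.TTheory GRing.Theory Num.Theory.
Import numFieldNormedType.Exports.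

Local Open Scope classical_set_scope.
Local Open Scope ring_scope.

(** Let r = A xstar - b. It is orthogonal to the range of A, so some
orthogonal change of basis of R^n turns A into an invertible d x d block T on
top of zeros, and r into a multiple of the basis vector of index d
([least_squares_normal_form]). The law of an i.i.d. Gaussian matrix is
invariant under orthogonal maps, so the sketch expressed in this basis has the
same law as before. If G is the matrix of its first d columns, g the next
column and W = G^T G, the normal equations of the sketched problem give

  f(xhat) / f(xstar) - 1 = |W^-1 G^T g|^2      ([sketched_ratio]),

which no longer involves A and b.

The core of the proof is that this quantity has the law of a ratio of sums of
squares of distinct entries of a Gaussian matrix, d of them above and m - d + 1
below ([excess_law]). It follows from three orthogonal changes of variables;
each of them moves one block of entries by a rotation that may depend on the
remaining entries.
 - G fixed, g rotated. By the singular value decomposition of G W^-1, the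
   number |W^-1 G^T g|^2 becomes z^T W^-1 z, where z consists of the first d
   coordinates of g ([sketch_le_quad]).
 - g fixed, rows of G rotated. Turning z to the first axis changes z^T W^-1 z
   into |z|^2 (W^-1)_00 ([quad_le_axis]).
 - All columns of G but the first fixed, the first one rotated. (W^-1)_00 is
   the inverse of the squared distance of the first column to the span of the
   others; when this span is turned into that of the first d - 1 basis vectors,
   the squared distance becomes the sum of the squares of the last m - d + 1
   coordinates ([axis_le_ratio]).
Only the law of the event before and after the change of variables matters, and
by Fubini the entries on which the rotation depends can be frozen first. Hence
the rotation need not be a measurable function of them
([measure_le_of_rotation]).

Chernoff bounds for the two sums of squares ([chi2_concentration]) then control
the deviation of the ratio from d / (m - d + 1), hence from its mean
d / (m - d - 1): the two differ by O(1/m), which is below eps unless eps m is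
bounded, and in that case a large constant C1 makes the claim empty
([ratio_close]). The exponent obtained is of order eps^2 m, better than eps^4 m
as eps is bounded.

Orthogonal invariance itself is proved from the rotation invariance of the
plane Gaussian law: a plane rotation is a product of three shears, which
preserve Lebesgue measure by Fubini and translation invariance; and a QR
decomposition by plane rotations writes every orthogonal matrix as a product of
plane rotations and changes of sign. *)

(** * Rotation invariance of plane Lebesgue measure *)

(** [lebesgue_measure] lives on a copy of R with the same Borel sets. It is
transported along this identity, so that product measures live on R * R. *)
Definition borel_id {R : realType} (x : measurableTypeR R) : R := x.

Lemma measurable_borel_id {R : realType} : measurable_fun setT (@borel_id R).
Proof. exact: measurable_id. Qed.

HB.instance Definition _ (R : realType) :=
  isMeasurableFun.Build _ _ _ _ (@borel_id R) measurable_borel_id.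

Definition lebR {R : realType} : set R -> \bar R :=
  pushforward (@lebesgue_measure R) borel_id.

Lemma lebR0 {R : realType} : @lebR R set0 = 0%E.
Proof. exact: (measure0 (@lebesgue_measure R)). Qed.

Lemma lebR_ge0 {R : realType} A : (0 <= @lebR R A)%E.
Proof. exact: (measure_ge0 (@lebesgue_measure R)). Qed.

Lemma lebR_semi_sigma_additive {R : realType} : semi_sigma_additive (@lebR R).
Proof. exact: (@measure_semi_sigma_additive _ _ _ (@lebesgue_measure R)). Qed.

HB.instance Definition _ (R : realType) := isMeasure.Build _ _ _ (@lebR R)
  lebR0 lebR_ge0 lebR_semi_sigma_additive.

Lemma sigma_finite_lebR {R : realType} : sigma_finite setT (@lebR R).
Proof. exact: (@sigma_finiteT _ _ _ (@lebesgue_measure R)). Qed.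

HB.instance Definition _ (R : realType) :=
  Measure_isSigmaFinite.Build _ _ _ (@lebR R) sigma_finite_lebR.

Section lebR.
Context {R : realType}.
Local Notation leb := (@lebesgue_measure R).
Local Notation lebR := (@lebR R).

Lemma ge0_integral_lebR (f : R -> \bar R) :
  measurable_fun setT f -> (forall x, 0 <= f x)%E ->
  (\int[lebR]_x f x = \int[leb]_x f x)%E.
Proof.
move=> mf f0.
exact: (@ge0_integral_pushforward _ _ _ _ R _ measurable_borel_id leb setT f
    measurableT mf (fun x _ => f0 x)).
Qed.

Lemma lebR_translate (a : R) (A : set R) : measurable A ->
  lebR ((fun x => x + a) @^-1` A) = lebR A.
Proof.
move=> mA; have mf : measurable_fun setT (fun x : measurableTypeR R => (x + a :
    measurableTypeR R)).
  exact: measurable_funD.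
pose f : {mfun measurableTypeR R >-> measurableTypeR R} :=
  HB.pack (fun x : measurableTypeR R => x + a : measurableTypeR R)
    (isMeasurableFun.Build _ _ _ _ _ mf).
apply/esym/(@lebesgue_measure_unique _ (pushforward leb f)) => //= _ [[u v]] _ <-.
rewrite /pushforward/=.
rewrite (_ : _ @^-1` _ = `]u - a, v - a]%classic); last first.
  by apply/seteqP; split => x /=; rewrite !in_itv/= ltrBlDr lerBrDr.
rewrite !lebesgue_measure_itv/= !lte_fin ltrD2r.
by case: ifP => //; rewrite -!EFinB => _; congr (_%:E); ring.
Qed.

Lemma ge0_integral_translate (a : R) (f : R -> \bar R) :
  measurable_fun setT f -> (forall x, 0 <= f x)%E ->
  (\int[lebR]_x f (x + a)%R = \int[lebR]_x f x)%E.
Proof.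
move=> mf f0; have mphi : measurable_fun setT (fun x : R => x + a).
  exact: measurable_funD.
have := @ge0_integral_pushforward _ _ _ _ R _ mphi lebR setT f measurableT mf (fun
    x _ => f0 x).
rewrite preimage_setT => <-.
by apply: eq_measure_integral => //= A mA _; rewrite -[RHS](lebR_translate a).
Qed.

Local Notation leb2 := (lebR \x lebR)%E.

Lemma ge0_integral_shear1 (t : R) (f : R * R -> \bar R) :
  measurable_fun setT f -> (forall x, 0 <= f x)%E ->
  (\int[leb2]_z f (z.1 + t * z.2, z.2)%R = \int[leb2]_z f z)%E.
Proof.
move=> mf f0.
have ms : measurable_fun setT (fun z : R * R => f (z.1 + t * z.2, z.2)).
  apply: measurableT_comp => //; apply: measurable_fun_pair => //.
  by apply: measurable_funD => //; apply: measurable_funM.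
rewrite fubini_tonelli2// fubini_tonelli2//.
apply: eq_integral => y _ /=.
apply: (@ge0_integral_translate (t * y) (fun x => f (x, y))) => //.
by apply: measurableT_comp => //; apply: measurable_fun_pair.
Qed.

Lemma ge0_integral_shear2 (t : R) (f : R * R -> \bar R) :
  measurable_fun setT f -> (forall x, 0 <= f x)%E ->
  (\int[leb2]_z f (z.1, z.2 + t * z.1)%R = \int[leb2]_z f z)%E.
Proof.
move=> mf f0.
have ms : measurable_fun setT (fun z : R * R => f (z.1, z.2 + t * z.1)).
  apply: measurableT_comp => //; apply: measurable_fun_pair => //.
  by apply: measurable_funD => //; apply: measurable_funM.
rewrite fubini_tonelli1// fubini_tonelli1//.
apply: eq_integral => x _ /=.
apply: (@ge0_integral_translate (t * x) (fun y => f (x, y))) => //.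
by apply: measurableT_comp => //; apply: measurable_fun_pair.
Qed.

(** A rotation whose matrix has a nonzero entry off the diagonal is a product
of three shears. *)
Lemma ge0_integral_rotation (c s : R) (f : R * R -> \bar R) :
  s != 0 -> c ^+ 2 + s ^+ 2 = 1 ->
  measurable_fun setT f -> (forall x, 0 <= f x)%E ->
  (\int[leb2]_z f (c * z.1 + s * z.2, c * z.2 - s * z.1)%R = \int[leb2]_z f z)%E.
Proof.
(* [t] is the tangent of the half angle. *)
move=> s0 cs1 mf f0; pose t := (1 - c) / s.
have mp (g h : R * R -> R) : measurable_fun setT g -> measurable_fun setT h ->
    measurable_fun setT (fun z => f (g z, h z)).
  by move=> mg mh; apply: measurableT_comp => //; apply: measurable_fun_pair.
rewrite -[RHS](ge0_integral_shear1 t)//.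
rewrite -(ge0_integral_shear2 (- s) (f := fun z => f (z.1 + t * z.2, z.2)))//;
    last first.
  by apply: mp => //; apply: measurable_funD => //; apply: measurable_funM.
rewrite -(ge0_integral_shear1 t (f := fun z => f (z.1 + t * (z.2 + - s * z.1), z.2
    + - s * z.1)))//; last first.
  have m2 : measurable_fun setT (fun z : R * R => z.2 + - s * z.1).
    by apply: measurable_funD => //; apply: measurable_funM.
  by apply: mp => //; apply: measurable_funD => //; apply: measurable_funM.
apply: eq_integral => -[x y] _ /=.
have ct : c = 1 - t * s by rewrite /t divfK// subKr.
have st : t * (1 + c) = s.
  apply: (mulIf s0); rewrite mulrAC /t divfK// -[RHS]expr2.
  by rewrite -[s ^+ 2](addKr (c ^+ 2)) cs1; ring.
congr (f (_, _)); last by rewrite ct; ring.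
by rewrite -[s in LHS]st ct; ring.
Qed.

End lebR.

(** * The centred Gaussian law on the line *)

Lemma ge0_integral_density d (T : measurableType d) (R : realType)
    (nu : {finite_measure set T -> \bar R})
    (mu : {sigma_finite_measure set T -> \bar R}) (g f : T -> \bar R) :
  measurable_fun setT g -> (forall x, 0 <= g x)%E ->
  (forall A, measurable A -> nu A = \int[mu]_(x in A) g x)%E ->
  measurable_fun setT f -> (forall x, 0 <= f x)%E ->
  (\int[nu]_x f x = \int[mu]_x (f x * g x))%E.
Proof.
move=> mg g0 nuE mf f0.
have numu : nu `<< mu.
  apply/null_content_dominatesP => A mA muA0; rewrite nuE//.
  by apply: null_set_integral => //; exact: measurable_funTS.
rewrite -(Radon_Nikodym_SigmaFinite.change_of_variables numu)//.
have mrn : measurable_fun setT (Radon_Nikodym_SigmaFinite.f nu mu).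
  exact: measurable_int (Radon_Nikodym_SigmaFinite.f_integrable numu).
apply: ae_eq_integral => //; [exact: emeasurable_funM..|].
apply: ae_eqe_mul2l; apply: integral_ae_eq => //.
  exact: Radon_Nikodym_SigmaFinite.f_integrable.
by move=> E _ mE; rewrite -Radon_Nikodym_SigmaFinite.f_integral// nuE.
Qed.

Lemma measure_indic d (T : measurableType d) (R : realType)
    (mu : {measure set T -> \bar R}) (A : set T) : measurable A ->
  mu A = (\int[mu]_x (\1_A x)%:E)%E.
Proof. by move=> mA; rewrite integral_indic// setIT. Qed.

Definition gaussR {R : realType} (s : R) : set R -> \bar R := normal_prob 0 s.

Lemma gaussR0 {R : realType} (s : R) : gaussR s set0 = 0%E.
Proof. exact: (measure0 (normal_prob 0 s)). Qed.

Lemma gaussR_ge0 {R : realType} (s : R) A : (0 <= gaussR s A)%E.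
Proof. exact: (measure_ge0 (normal_prob 0 s)). Qed.

Lemma gaussR_semi_sigma_additive {R : realType} (s : R) :
  semi_sigma_additive (gaussR s).
Proof. exact: (@measure_semi_sigma_additive _ _ _ (normal_prob 0 s)). Qed.

HB.instance Definition _ (R : realType) (s : R) := isMeasure.Build _ _ _
  (gaussR s) (gaussR0 s) (gaussR_ge0 s) (gaussR_semi_sigma_additive (s:=s)).

Lemma gaussRT {R : realType} (s : R) : gaussR s setT = 1%E.
Proof. exact: (probability_setT (normal_prob 0 s)). Qed.

HB.instance Definition _ (R : realType) (s : R) :=
  Measure_isProbability.Build _ _ R (gaussR s) (gaussRT s).

Section gaussian_line.
Context {R : realType}.
Variable s : R.
Local Notation pdf := (normal_pdf 0 s).
Local Notation leb := (@lebR R).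

Lemma measurable_pdf : measurable_fun (setT : set R) (EFin \o pdf).
Proof. by apply/measurable_EFinP; exact: measurable_normal_pdf. Qed.

Lemma ge0_integral_gaussR (f : R -> \bar R) :
  measurable_fun setT f -> (forall x, 0 <= f x)%E ->
  (\int[gaussR s]_x f x = \int[leb]_x (f x * (pdf x)%:E))%E.
Proof.
move=> mf f0; apply: ge0_integral_density => //.
- exact: measurable_pdf.
- by move=> x; rewrite lee_fin normal_pdf_ge0.
move=> A mA; rewrite /gaussR /normal_prob.
have := @ge0_integral_pushforward _ _ _ _ R _ measurable_borel_id lebesgue_measure
    A (EFin \o pdf) mA.
move=> h; symmetry; apply: h.
  exact: measurable_funTS measurable_pdf.
by move=> x _; rewrite lee_fin normal_pdf_ge0.
Qed.

Lemma gaussR_set1 (a : R) : gaussR s [set a] = 0%E.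
Proof.
have /null_content_dominatesP h := normal_prob_dominates 0 s.
by apply: h; [exact: measurable_set1|exact: lebesgue_measure_set1].
Qed.

Hypothesis s0 : s != 0.

Lemma pdfE (x : R) :
  pdf x = normal_peak s * expR (- (x ^+ 2) / (s ^+ 2 *+ 2)).
Proof. by rewrite (normal_pdfE _ s0) /normal_fun subr0. Qed.

Lemma pdf_rotation (c t x y : R) : c ^+ 2 + t ^+ 2 = 1 ->
  pdf (c * x + t * y) * pdf (c * y - t * x) = pdf x * pdf y.
Proof.
move=> ct1; rewrite !pdfE mulrACA -expRD [RHS]mulrACA -expRD.
congr (_ * expR _); rewrite -!mulrDl; congr (_ / _).
by rewrite -[RHS]mulr1 -ct1; ring.
Qed.

(** The density of the product law is the product of the densities. *)
Lemma ge0_integral_gaussR2 (f : R * R -> \bar R) :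
  measurable_fun setT f -> (forall x, 0 <= f x)%E ->
  (\int[gaussR s \x gaussR s]_z f z =
   \int[leb \x leb]_z (f z * (pdf z.1 * pdf z.2)%:E))%E.
Proof.
move=> mf f0.
have mfx x : measurable_fun setT (fun y => f (x, y)).
  by apply: measurableT_comp => //; apply: measurable_fun_pair.
have mpdf (g : R * R -> R) : measurable_fun setT g ->
    measurable_fun setT (fun z => (pdf (g z))%:E).
  by move=> mg; apply: (measurableT_comp measurable_pdf).
have pdf0 x : (0 <= (pdf x)%:E)%E by rewrite lee_fin normal_pdf_ge0.
pose g z := (f z * (pdf z.2)%:E)%E.
have mg : measurable_fun setT g by apply: emeasurable_funM => //; apply: mpdf.
have g0 z : (0 <= g z)%E by rewrite mule_ge0.
rewrite fubini_tonelli1//=.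
under eq_integral do rewrite /fubini_F ge0_integral_gaussR//.
rewrite ge0_integral_gaussR//; last 2 first.
- exact: (measurable_fun_fubini_tonelli_F (m2 := leb) g mg g0).
- by move=> x; apply: integral_ge0 => y _; exact: g0.
rewrite fubini_tonelli1//=; last 2 first.
- under eq_fun do rewrite EFinM.
  apply: emeasurable_funM => //; apply: emeasurable_funM; exact: mpdf.
- by move=> z; rewrite mule_ge0// lee_fin mulr_ge0 ?normal_pdf_ge0.
apply: eq_integral => x _; rewrite /fubini_F -ge0_integralZr//=.
- by apply: eq_integral => y _; rewrite EFinM -muleA [X in (_ * X = _)%E]muleC.
- exact: (measurableT_comp mg).
- by move=> y _; exact: (g0 (x, y)).
Qed.

Lemma gaussR2_rotation (c t : R) (E : set (R * R)) :
  t != 0 -> c ^+ 2 + t ^+ 2 = 1 -> measurable E ->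
  (gaussR s \x gaussR s)%E [set z | E (c * z.1 + t * z.2, c * z.2 - t * z.1)] =
  (gaussR s \x gaussR s)%E E.
Proof.
move=> t0 ct1 mE.
have mphi : measurable_fun setT (fun z : R * R => (c * z.1 + t * z.2, c * z.2 - t *
    z.1)).
  apply: measurable_fun_pair.
    by apply: measurable_funD => //; apply: measurable_funM.
  by apply: measurable_funB => //; apply: measurable_funM.
have mE' : measurable [set z : R * R | E (c * z.1 + t * z.2, c * z.2 - t * z.1)].
  by rewrite -[X in measurable X]setTI; exact: mphi.
rewrite (measure_indic _ mE') (measure_indic _ mE).
have mpdf (g : R * R -> R) : measurable_fun setT g ->
    measurable_fun setT (fun z => (pdf (g z))%:E).
  by move=> mg; apply: (measurableT_comp measurable_pdf).
rewrite !ge0_integral_gaussR2//; last 2 first.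
- exact/measurable_EFinP/measurable_indic.
- exact/measurable_EFinP/measurable_indic.
rewrite -[RHS](ge0_integral_rotation t0 ct1); last 2 first.
- apply: emeasurable_funM; first exact/measurable_EFinP/measurable_indic.
  by under eq_fun do rewrite EFinM; apply: emeasurable_funM; exact: mpdf.
- by move=> z; rewrite mule_ge0// lee_fin mulr_ge0 ?normal_pdf_ge0.
by apply: eq_integral => z _ /=; rewrite pdf_rotation//.
Qed.

Lemma gaussRN (E : set R) : measurable E -> gaussR s [set x | E (- x)] = gaussR s E.
Proof.
move=> mE.
have mphi : measurable_fun setT (-%R : R -> R) by exact: oppr_measurable.
have mE' : measurable [set x : R | E (- x)].
  by rewrite -[X in measurable X]setTI; exact: mphi.
rewrite (measure_indic _ mE') (measure_indic _ mE).
rewrite !ge0_integral_gaussR//; last 2 first.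
- exact/measurable_EFinP/measurable_indic.
- exact/measurable_EFinP/measurable_indic.
pose f x := ((\1_E x)%:E * (pdf x)%:E)%E.
have mf : measurable_fun setT f.
  apply: emeasurable_funM; first exact/measurable_EFinP/measurable_indic.
  exact: measurable_pdf.
have f0 x : (0 <= f x)%E by rewrite mule_ge0// lee_fin normal_pdf_ge0.
have := @ge0_integral_pushforward _ _ _ _ R _ mphi leb setT f measurableT mf (fun x
    _ => f0 x).
rewrite preimage_setT => h; transitivity (\int[leb]_x (f \o -%R) x)%E.
  by apply: eq_integral => x _; rewrite /f/= !pdfE sqrrN.
rewrite -h; apply: eq_measure_integral => A mA _; exact: lebesgue_measureN.
Qed.

(** Up to a constant, the integrand times the density of the law of deviation
[s] is the density of the law of deviation [s / sqrt (1 - 2 l)]. *)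
Lemma gaussR_sqr_mgf (l : R) : l < 2^-1 ->
  (\int[gaussR s]_x (expR (l * (x / s) ^+ 2))%:E = ((Num.sqrt (1 - 2 * l))^-1)%:E)%E.
Proof.
move=> l2; have l0 : 0 < 1 - 2 * l by lra.
pose q := Num.sqrt (1 - 2 * l).
have q0 : 0 < q by rewrite sqrtr_gt0.
have q2 : q ^+ 2 = 1 - 2 * l by rewrite sqr_sqrtr// ltW.
pose s' := s / q.
have s'0 : s' != 0 by rewrite mulf_neq0// invr_neq0// gt_eqF.
have mexp : measurable_fun setT (fun x : R => (expR (l * (x / s) ^+ 2))%:E).
  apply/measurable_EFinP; apply: measurableT_comp => //.
  by apply: measurable_funM => //; apply: measurable_funX; apply: measurable_funM.
rewrite ge0_integral_gaussR//.
have mp : measurable_fun setT (fun x : R => (normal_pdf 0 s' x)%:E).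
  by apply/measurable_EFinP; exact: measurable_normal_pdf.
have p0 (x : R) : (0 <= (normal_pdf 0 s' x)%:E)%E by rewrite lee_fin normal_pdf_ge0.
have qV0 : (0 <= (q^-1)%:E)%E by rewrite lee_fin invr_ge0 ltW.
have intp : (\int[leb]_x (normal_pdf 0 s' x)%:E = 1)%E.
  by rewrite ge0_integral_lebR// integral_normal_pdf.
rewrite -[RHS]mule1 -intp -ge0_integralZl//.
apply: eq_integral => x _; rewrite -!EFinM pdfE (normal_pdfE _ s'0); congr (_%:E).
have -> : normal_peak s' = q * normal_peak s.
  rewrite /normal_peak /s'.
  have sp : 0 <= s ^+ 2 * pi *+ 2 by rewrite mulrn_wge0// mulr_ge0 ?sqr_ge0 ?pi_ge0.
  rewrite (_ : (s / q) ^+ 2 * pi *+ 2 = (q^-1) ^+ 2 * (s ^+ 2 * pi *+ 2));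
      last by ring.
  by rewrite sqrtrM ?sqr_ge0// sqrtr_sqr ger0_norm ?invr_ge0 ?ltW// invfM invrK.
rewrite /normal_fun subr0 -(mulrA q) mulKf ?gt_eqF// mulrCA -expRD.
congr (_ * expR _); rewrite /s' !expr_div_n q2.
by field; rewrite s0 andbT gt_eqF.
Qed.

(** The exponent is the expansion of -1/2 ln (1 - 2 l) to second order, with a
larger constant in front of [l ^+ 2]. *)
Lemma gaussR_sqr_mgf_le (l : R) : - 8^-1 <= l <= 8^-1 ->
  (\int[gaussR s]_x (expR (l * (x / s) ^+ 2))%:E <= (expR (l + 2 * l ^+ 2))%:E)%E.
Proof.
move=> /andP[l1 l2].
have p0 : 0 < 1 - 2 * l by lra.
rewrite gaussR_sqr_mgf; last lra.
set w := l + 2 * l ^+ 2; rewrite lee_fin -[w]opprK expRN.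
rewrite lef_pV2 ?posrE ?sqrtr_gt0 ?expR_gt0// -ler_sqr ?nnegrE ?sqrtr_ge0 ?expR_ge0//.
rewrite sqr_sqrtr ?(ltW p0)// -[leLHS]mulr1.
have e1 : 1 + w <= expR w := expR_ge1Dx w.
have w0 : 0 <= 1 + w by rewrite /w; nra.
have e2 : 1 <= (1 - 2 * l) * expR w ^+ 2.
  apply: (@le_trans _ _ ((1 - 2 * l) * (1 + w) ^+ 2)); last first.
    by rewrite ler_pM2l// ler_sqr ?nnegrE ?expR_ge0.
  rewrite (_ : (1 - 2 * l) * (1 + w) ^+ 2 = 1 + (2 * l) ^+ 2 * (- (2 * l) + (1 - 2
      * l) * (1 + 2 * l) ^+ 2 / 4)); last first.
    by rewrite /w; field.
  rewrite lerDl mulr_ge0 ?sqr_ge0//.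
  by nra.
rewrite mulr1 expRN exprVn -[leRHS]mul1r -ler_pdivrMr// mulrC.
by rewrite -invfM invf_le1// mulr_gt0// exprn_gt0// expR_gt0.
Qed.

End gaussian_line.

(** * Gaussian matrices *)

Section mxspace.
Context {R : realType}.

Definition mxbox m n (B : 'I_m * 'I_n -> set R) : set 'M[R]_(m, n) :=
  [set v | forall p, B p (v p.1 p.2)].

(** Boxes form a class closed under intersections, so that two finite measures
on matrices agree as soon as they agree on boxes. *)
Definition mxboxes m n : set (set 'M[R]_(m, n)) :=
  [set E | exists2 B : 'I_m * 'I_n -> set R, (forall p, measurable (B p)) & E =
      mxbox B].

End mxspace.

Notation mxspace R m n := (g_sigma_algebraType (@mxboxes R m n)).

Section mxspace_theory.
Context {R : realType}.

Lemma measurable_mxbox m n (B : 'I_m * 'I_n -> set R) :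
  (forall p, measurable (B p)) -> measurable (mxbox B : set (mxspace R m n)).
Proof. by move=> mB; apply: sub_sigma_algebra; exists B. Qed.

Lemma mxbox_setI m n : setI_closed (@mxboxes R m n).
Proof.
move=> _ _ [B mB ->] [C mC ->]; exists (fun p => B p `&` C p).
  by move=> p; exact: measurableI.
apply/seteqP; split => v /=; first by move=> [vB vC] p; split.
by move=> vBC; split => p; have [] := vBC p.
Qed.

Lemma mxboxT m n : mxbox (fun _ : 'I_m * 'I_n => [set: R]) = setT.
Proof. by apply/seteqP; split. Qed.

Lemma measurable_coord m n (i : 'I_m) (j : 'I_n) :
  measurable_fun setT (fun v : mxspace R m n => v i j).
Proof.
move=> _ B mB; rewrite setTI.
rewrite (_ : _ @^-1` B = mxbox (fun p => if p == (i, j) then B else setT)).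
  by apply: measurable_mxbox => p; case: ifP.
apply/seteqP; split => v /=; last by move=> /(_ (i, j)); rewrite eqxx.
by move=> Bv p; case: eqP => // ->.
Qed.

Lemma measurable_mx d (T : measurableType d) m n (f : T -> mxspace R m n) :
  (forall i j, measurable_fun setT (fun t => f t i j)) -> measurable_fun setT f.
Proof.
move=> mf; apply: (@measurability _ _ T (mxspace R m n) setT f (@mxboxes R m n)) =>
    // _ [_ [B mB ->] <-].
rewrite setTI (_ : _ @^-1` _ = \bigcap_(p in [set: 'I_m * 'I_n]) [set t | B p (f t
    p.1 p.2)]).
  apply: fin_bigcap_measurable; first exact: finite_finset.
  by move=> p _; rewrite -[X in measurable X]setTI; exact: mf.
by apply/seteqP; split => t /=; [move=> + p _; apply|move=> + p; apply].
Qed.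

Lemma mxspace_unique m n (mu1 mu2 : {measure set (mxspace R m n) -> \bar R}) :
  (mu1 setT < +oo)%E ->
  (forall B, (forall p, measurable (B p)) -> mu1 (mxbox B) = mu2 (mxbox B)) ->
  forall E, measurable E -> mu1 E = mu2 E.
Proof.
move=> mu1T mu12; apply: (@measure_unique _ R (mxspace R m n) (@mxboxes R m n)
    (fun=> setT)) => //.
- exact: mxbox_setI.
- by move=> _; exists (fun=> setT) => //; rewrite mxboxT.
- by rewrite bigcup_const//; exists 0%N.
- by move=> _ [B mB ->]; exact: mu12.
Qed.

(** I.i.d. entries of law N(0, s^2), stated on boxes. *)
Definition gaussian_law (s : R) m n (mu : probability (mxspace R m n) R) :=
  forall B, (forall p, measurable (B p)) ->
    mu (mxbox B) = (\prod_(p : 'I_m * 'I_n) gaussR s (B p))%E.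

(** Resampling: the entries in [J] are those of [y], the others those of [v]. *)
Definition merge m n (J : pred ('I_m * 'I_n)) (v y : 'M[R]_(m, n)) : 'M[R]_(m, n) :=
  \matrix_(i, j) if J (i, j) then y i j else v i j.

Lemma measurable_merge m n (J : pred ('I_m * 'I_n)) :
  measurable_fun setT (fun z : mxspace R m n * mxspace R m n =>
    merge J z.1 z.2 : mxspace R m n).
Proof.
apply: measurable_mx => i j; rewrite /merge; under eq_fun do rewrite mxE.
case: (J _).
  exact: (measurableT_comp (measurable_coord i j) measurable_snd).
exact: (measurableT_comp (measurable_coord i j) measurable_fst).
Qed.

Lemma measurable_merge2 m n (J : pred ('I_m * 'I_n)) (v : 'M[R]_(m, n)) :
  measurable_fun setT (fun y : mxspace R m n => merge J v y : mxspace R m n).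
Proof.
apply: measurable_mx => i j; rewrite /merge; under eq_fun do rewrite mxE.
by case: (J _); [exact: (measurable_coord i j)|exact: measurable_cst].
Qed.

Lemma measurable_preimage_set d d' (T : measurableType d) (T' : measurableType d')
  (f : T -> T') (E : set T') : measurable_fun setT f -> measurable E ->
  measurable [set t | E (f t)].
Proof. by move=> mf mE; rewrite -[X in measurable X]setTI; exact: mf. Qed.

Section law.
Variables (s : R) (m n : nat) (mu : probability (mxspace R m n) R).
Hypothesis mu_gauss : gaussian_law s mu.

(** Independence of the entries in [J] from the others: resampling the entries
in [J] from an independent copy does not change the law. *)
Lemma gaussian_merge (J : pred ('I_m * 'I_n)) (E : set (mxspace R m n)) :
  measurable E ->
  (mu E = \int[mu]_v mu [set y | E (merge J v y)])%E.
Proof.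
move=> mE; pose f (z : mxspace R m n * mxspace R m n) : mxspace R m n :=
    merge J z.1 z.2.
have mf : measurable_fun setT f by exact: measurable_merge.
pose F : {mfun (mxspace R m n * mxspace R m n)%type >-> mxspace R m n} :=
  HB.pack f (isMeasurableFun.Build _ _ _ _ _ mf).
transitivity (pushforward (mu \x mu)%E F E); last first.
  rewrite /pushforward/= /product_measure1/=.
  by apply: eq_integral => v _ /=; congr (mu _); apply/seteqP; split => y /=;
      rewrite xsectionE.
apply: (@mxspace_unique _ _ mu (pushforward (mu \x mu)%E F)) => //.
  exact: (le_lt_trans (probability_le1 mu measurableT) (ltry 1)).
move=> B mB; apply: etrans; first exact: mu_gauss.
set B1 := fun p => if J p then setT else B p.
set B2 := fun p => if J p then B p else setT.
have mB1 p : measurable (B1 p) by rewrite /B1; case: (J p).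
have mB2 p : measurable (B2 p) by rewrite /B2; case: (J p).
have fE : f @^-1` mxbox B = mxbox B1 `*` mxbox B2.
  apply/seteqP; split; case=> v y; rewrite /f /merge/=.
    by move=> h; split => -[i j]; rewrite /B1 /B2/=; have := h (i, j);
        rewrite /= mxE; case: (J _).
  move=> [h1 h2] [i j] /=; have := h1 (i, j); have := h2 (i, j).
  by rewrite /B1 /B2/= mxE; case: (J _).
transitivity ((mu \x mu)%E (mxbox B1 `*` mxbox B2)); last by rewrite -fE.
rewrite product_measure1E ?measurable_mxbox//.
rewrite [X in (_ = X * _)%E]mu_gauss// [X in (_ = _ * X)%E]mu_gauss//.
rewrite -big_split/=; apply: eq_bigr => p _.
  by rewrite /B1 /B2; case: (J p); rewrite gaussRT ?mule1 ?mul1e.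
all: exact: measurable_mxbox.
Qed.

Lemma gaussian_coord (i : 'I_m) (j : 'I_n) (A : set R) : measurable A ->
  mu [set y | A (y i j)] = gaussR s A.
Proof.
move=> mA; transitivity (mu (mxbox (fun p => if p == (i, j) then A else setT))).
  congr (mu _); apply/seteqP; split => v /=; last by move=> /(_ (i, j)); rewrite eqxx.
  by move=> Bv p; case: eqP => // ->.
rewrite mu_gauss; last by move=> p; case: ifP.
by rewrite (bigD1 (i, j))//= eqxx big1 ?mule1// => p /negbTE ->; rewrite gaussRT.
Qed.

Lemma gaussian_coord2 (p q : 'I_m * 'I_n) (A : set (R * R)) : p != q ->
    measurable A ->
  mu [set y | A (y p.1 p.2, y q.1 q.2)] = (gaussR s \x gaussR s)%E A.
Proof.
move=> pq mA; pose f (y : mxspace R m n) : R * R := (y p.1 p.2, y q.1 q.2).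
have mf : measurable_fun setT f by apply: measurable_fun_pair;
    [exact: (measurable_coord p.1 p.2)|exact: (measurable_coord q.1 q.2)].
pose F : {mfun mxspace R m n >-> (R * R)%type} :=
  HB.pack f (isMeasurableFun.Build _ _ _ _ _ mf).
apply/esym/(@product_measure_unique _ _ _ _ R (gaussR s) (gaussR s) (pushforward mu
    F)) => //.
move=> B C mB mC.
set D := fun r => if r == p then B else if r == q then C else setT.
have mD r : measurable (D r) by rewrite /D; case: ifP => // _; case: ifP.
have fE : f @^-1` (B `*` C) = mxbox D.
  apply/seteqP; split => v /=; rewrite /f/=.
    by move=> [vB vC] r; rewrite /D; case: eqP => [->//|_]; case: eqP => // ->.
  move=> h; have := h p; have := h q.
  by rewrite /D eqxx [q == p]eq_sym (negbTE pq) eqxx.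
transitivity (mu (mxbox D)); first by rewrite -fE.
rewrite mu_gauss// /D.
rewrite (bigD1 p)//= eqxx (bigD1 q) 1?eq_sym//= eqxx (negbTE pq).
by rewrite big1 ?mule1// => r /andP[/negbTE -> /negbTE ->]; rewrite gaussRT.
Qed.

End law.
End mxspace_theory.

(** * QR decomposition by plane rotations *)

Section qr.
Context {R : realType}.

Definition orthmx n (Q : 'M[R]_n) : Prop := Q^T *m Q = 1%:M.

Lemma orthmx_mulVr n (Q : 'M[R]_n) : orthmx Q -> Q *m Q^T = 1%:M.
Proof. exact: mulmx1C. Qed.

Lemma orthmx1 n : orthmx (1%:M : 'M[R]_n).
Proof. by rewrite /orthmx trmx1 mulmx1. Qed.

Lemma orthmxM n (P Q : 'M[R]_n) : orthmx P -> orthmx Q -> orthmx (P *m Q).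
Proof. by move=> oP oQ; rewrite /orthmx trmx_mul mulmxA -(mulmxA Q^T) oP mulmx1. Qed.

Lemma orthmx_tr n (Q : 'M[R]_n) : orthmx Q -> orthmx Q^T.
Proof. by move=> oQ; rewrite /orthmx trmxK orthmx_mulVr. Qed.

Definition rotrows m n (j k : 'I_m) (c t : R) (s : pred 'I_n) (A :
    'M[R]_(m, n)) : 'M[R]_(m, n) :=
  \matrix_(i, l) if s l then
    if i == j then c * A j l + t * A k l
    else if i == k then c * A k l - t * A j l else A i l
  else A i l.

Definition givens m (j k : 'I_m) (c t : R) : 'M[R]_m := rotrows j k c t predT 1%:M.

Lemma givensE m n (j k : 'I_m) (c t : R) (A : 'M[R]_(m, n)) :
  givens j k c t *m A = rotrows j k c t predT A.
Proof.
have row1 i l : \sum_b (1%:M : 'M[R]_m) i b * A b l = A i l.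
  by rewrite -[RHS](congr1 (fun M : 'M[R]_(m, n) => M i l) (mul1mx A)) mxE.
apply/matrixP => i l; rewrite !mxE /=; under eq_bigr do rewrite mxE /=.
case: (i == j).
  under eq_bigr do rewrite mulrDl -!mulrA.
  by rewrite big_split/= -!mulr_sumr !row1.
case: (i == k); last by rewrite row1.
under eq_bigr do rewrite mulrBl -!mulrA.
by rewrite sumrB/= -!mulr_sumr !row1.
Qed.

Lemma givens_orth m (j k : 'I_m) (c t : R) : j != k -> c ^+ 2 + t ^+ 2 = 1 ->
  orthmx (givens j k c t).
Proof.
move=> jk ct1; apply: mulmx1C; rewrite givensE.
have kj : k == j = false by rewrite eq_sym (negbTE jk).
apply/matrixP => a b; rewrite !mxE/= !(eq_sym b).
have [->|aj] := eqVneq a j; have [?|bj] := eqVneq b j; try subst b;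
  rewrite ?(negbTE aj) ?eqxx ?kj ?(negbTE jk) ?(negbTE bj) //=.
- by rewrite !mulr0 !mulr1 addr0 add0r -!expr2.
- by case: (k == b) => /=; ring.
- by case: (eqVneq a k) => _ /=; ring.
- have [ak|ak] := eqVneq a k; have [kb|kb] := eqVneq k b => /=.
  + by rewrite ak kb eqxx !mulr0 !mulr1 subr0 sub0r mulrN opprK -!expr2.
  + by rewrite ak (negbTE kb) /=; ring.
  + by rewrite -kb (negbTE ak) /=; ring.
  + by [].
Qed.

(** The condition [t != 0] is the one under which a plane rotation is a product
of shears. *)
Inductive rotation_product m : 'M[R]_m -> Prop :=
| rotation_product1 : rotation_product 1%:M
| rotation_productS (j k : 'I_m) (c t : R) Q : j != k -> t != 0 ->
    c ^+ 2 + t ^+ 2 = 1 -> rotation_product Q ->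
    rotation_product (givens j k c t *m Q).

Lemma rotation_product_orth m (Q : 'M[R]_m) : rotation_product Q -> orthmx Q.
Proof.
elim=> [|j k c t P jk _ ct _ oP]; first exact: orthmx1.
by apply: orthmxM => //; exact: givens_orth.
Qed.

Lemma rotation_productM m (P Q : 'M[R]_m) :
  rotation_product P -> rotation_product Q -> rotation_product (P *m Q).
Proof.
move=> + rQ; elim=> [|j k c t P' jk t0 ct _ rP]; first by rewrite mul1mx.
by rewrite -mulmxA; exact: rotation_productS.
Qed.

(** The entries of column [l] below row [j] are cleared one after the other,
each by a rotation of its row with row [j]. The last clause ensures that columns
cleared previously remain so. *)
Lemma clear_column m n (B : 'M[R]_(m, n)) (j : 'I_m) (l : 'I_n) (r : nat) :
  exists2 Q, rotation_product Q &
  [/\ forall i : 'I_m, (j < i < j.+1 + r)%N -> (Q *m B) i l = 0,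
      forall (i : 'I_m) h, (i < j)%N -> (Q *m B) i h = B i h &
      forall h, (forall i : 'I_m, (j <= i)%N -> B i h = 0) ->
        forall i : 'I_m, (j <= i)%N -> (Q *m B) i h = 0].
Proof.
elim: r => [|r [Q rQ [Q1 Q2 Q3]]].
  exists 1%:M; first exact: rotation_product1.
  rewrite mul1mx; split => // i; rewrite addn0 ltnS.
  by case/andP => /leq_trans h /h; rewrite ltnn.
have [jr|jr] := ltnP (j.+1 + r) m; last first.
  exists Q => //; split => // i /andP[ji _]; apply: Q1; rewrite ji/=.
  exact: leq_trans (ltn_ord i) jr.
pose k := Ordinal jr; set C := Q *m B in Q1 Q2 Q3 *.
have jk : (j < k)%N by rewrite /= addSn ltnS leq_addr.
have [Ck0|Ck0] := eqVneq (C k l) 0.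
  exists Q => //; split => // i /andP[ji]; rewrite addnS ltnS leq_eqVlt =>
      /orP[/eqP ik|ik].
    by rewrite (_ : i = k)//; exact: val_inj.
  by apply: Q1; rewrite ji.
have n0 : 0 < C j l ^+ 2 + C k l ^+ 2.
  by rewrite ltr_wpDl ?sqr_ge0// lt0r sqrf_eq0 Ck0 sqr_ge0.
pose q := Num.sqrt (C j l ^+ 2 + C k l ^+ 2).
have q2 : q ^+ 2 = C j l ^+ 2 + C k l ^+ 2 by rewrite sqr_sqrtr// ltW.
have q0 : q != 0 by rewrite gt_eqF// sqrtr_gt0.
have jk' : j != k by rewrite -val_eqE /= ltn_eqF.
have kj : k == j = false by rewrite eq_sym (negbTE jk').
exists (givens j k (C j l / q) (C k l / q) *m Q).
  apply: rotation_productS => //; first by rewrite mulf_neq0// invr_neq0.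
  by rewrite !expr_div_n -mulrDl -q2 divff// sqrf_eq0.
rewrite -mulmxA -/C givensE; split=> [i /andP[ji]|i h ij|h hB i ji].
- rewrite addnS ltnS leq_eqVlt => /orP[/eqP ik|ik].
    rewrite (_ : i = k); last exact: val_inj.
    by rewrite mxE /= kj eqxx; ring.
  have ij' : i == j = false by rewrite -val_eqE /= gtn_eqF.
  have ik' : i == k = false by rewrite -val_eqE /= ltn_eqF.
  by rewrite mxE/= ij' ik'; apply: Q1; rewrite ji.
- have ij' : i == j = false by rewrite -val_eqE /= ltn_eqF.
  have ik' : i == k = false by rewrite -val_eqE /= ltn_eqF// (ltn_trans ij).
  by rewrite mxE/= ij' ik'; exact: Q2.
- have C0 := Q3 h hB; rewrite mxE/= !C0//; last exact: ltnW.
  by rewrite !mulr0 addr0 subrr; case: ifP => //; case: ifP.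
Qed.

Lemma qr_decomposition m n (B : 'M[R]_(m, n)) :
  exists2 Q, rotation_product Q &
    forall (i : 'I_m) (l : 'I_n), (l < i)%N -> (Q *m B) i l = 0.
Proof.
suff H r : exists2 Q, rotation_product Q &
    forall (i : 'I_m) (l : 'I_n), (l < i)%N -> (l < r)%N -> (Q *m B) i l = 0.
  have [Q rQ h] := H n; exists Q => // i l li; exact: h.
elim: r => [|r [Q rQ h]]; first by exists 1%:M; first exact: rotation_product1.
have [rn|rn] := ltnP r n; last first.
  by exists Q => // i l li _; apply: h => //; exact: leq_trans rn.
have [rm|rm] := ltnP r m; last first.
  exists Q => // i l li; rewrite ltnS leq_eqVlt => /orP[/eqP lr|]; last exact: h.
  by have := leq_trans (ltn_ord i) rm; rewrite -lr ltnNge (ltnW li).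
have [P rP [P1 P2 P3]] := clear_column (Q *m B) (Ordinal rm) (Ordinal rn) m.
exists (P *m Q); first exact: rotation_productM.
move=> i l li; rewrite -mulmxA ltnS leq_eqVlt => /orP[/eqP lr|lr].
  rewrite (_ : l = Ordinal rn); last exact: val_inj.
  apply: P1; rewrite /= -lr li/= (leq_trans (ltn_ord i))// lr addSn.
  by rewrite ltnW// ltnS leq_addl.
have [ir|ri] := ltnP i r; first by rewrite P2//; exact: h.
by apply: P3 => //= k rk; apply: h => //; exact: leq_trans rk.
Qed.

End qr.

(** * Rotating two entries of a Gaussian matrix *)

(** The image of [mu] under [f] is [mu]. *)
Section preserves.
Context {R : realType}.

Lemma measurable_mxcomp d (T : measurableType d) m n (f : T -> mxspace R m n) i j :
  measurable_fun setT f -> measurable_fun setT (fun t => f t i j).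
Proof. by move=> mf; exact: (measurableT_comp (measurable_coord i j) mf). Qed.

Lemma measurable_mulmx d (T : measurableType d) m n p
    (f : T -> mxspace R m n) (g : T -> mxspace R n p) :
  measurable_fun setT f -> measurable_fun setT g ->
  measurable_fun setT (fun t => f t *m g t : mxspace R m p).
Proof.
move=> mf mg; apply: measurable_mx => i j; under eq_fun do rewrite mxE.
apply: measurable_sum => k; apply: measurable_funM; exact: measurable_mxcomp.
Qed.

Lemma measurable_trmx d (T : measurableType d) m n (f : T -> mxspace R m n) :
  measurable_fun setT f -> measurable_fun setT (fun t => (f t)^T : mxspace R n m).
Proof.
move=> mf; apply: measurable_mx => i j; under eq_fun do rewrite mxE.
exact: measurable_mxcomp.
Qed.

Lemma measurable_mulmxl m n p (M : 'M[R]_(p, m)) :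
  measurable_fun setT (mulmx M : mxspace R m n -> mxspace R p n).
Proof.
have mi : measurable_fun setT (fun v : mxspace R m n => v : mxspace R m n).
  exact: measurable_id.
have mc : measurable_fun setT (fun _ : mxspace R m n => M : mxspace R p m).
  exact: measurable_cst.
exact: (measurable_mulmx mc mi).
Qed.

Lemma measurable_mulmxr m n p (M : 'M[R]_(n, p)) :
  measurable_fun setT ((fun v => v *m M) : mxspace R m n -> mxspace R m p).
Proof.
have mi : measurable_fun setT (fun v : mxspace R m n => v : mxspace R m n).
  exact: measurable_id.
have mc : measurable_fun setT (fun _ : mxspace R m n => M : mxspace R n p).
  exact: measurable_cst.
exact: (measurable_mulmx mi mc).
Qed.

Lemma measurable_trmx_id m n :
  measurable_fun setT ((fun v => v^T) : mxspace R m n -> mxspace R n m).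
Proof.
have mi : measurable_fun setT (fun v : mxspace R m n => v : mxspace R m n).
  exact: measurable_id.
exact: (measurable_trmx mi).
Qed.

Definition preserves d (T : measurableType d) (mu : set T -> \bar R) (f : T -> T) :=
  measurable_fun setT f /\
  forall E : set T, measurable E -> mu [set v | E (f v)] = mu E.

Lemma preserves_id d (T : measurableType d) (mu : set T -> \bar R) : preserves mu id.
Proof. by split. Qed.

Lemma preserves_comp d (T : measurableType d) (mu : set T -> \bar R) (f g : T -> T) :
  preserves mu f -> preserves mu g -> preserves mu (f \o g).
Proof.
move=> [mf pf] [mg pg]; split; first exact: measurableT_comp.
by move=> E mE; rewrite -[RHS]pf//; rewrite -[RHS]pg//;
    exact: measurable_preimage_set.
Qed.

Section law.
Variables (s : R) (s0 : s != 0) (m n : nat) (mu : probability (mxspace R m n) R).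
Hypothesis mu_gauss : gaussian_law s mu.

Definition set_entry (p : 'I_m * 'I_n) (a : R) (v : 'M[R]_(m, n)) : 'M[R]_(m, n) :=
  \matrix_(i, j) if (i, j) == p then a else v i j.

Definition rotate_entries (p q : 'I_m * 'I_n) (c t : R) (v : mxspace R m n) :
    mxspace R m n :=
  set_entry p (c * v p.1 p.2 + t * v q.1 q.2) (set_entry q (c * v q.1 q.2 - t * v
      p.1 p.2) v).

(** Once the other entries are frozen, only the plane Gaussian law of the two
rotated entries matters. *)
Lemma preserves_rotate_entries (p q : 'I_m * 'I_n) (c t : R) :
  p != q -> t != 0 -> c ^+ 2 + t ^+ 2 = 1 ->
  preserves mu (rotate_entries p q c t).
Proof.
move=> pq t0 ct1; pose f := rotate_entries p q c t.
have mf : measurable_fun setT f.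
  have mc (a : 'I_m * 'I_n) : measurable_fun setT (fun v :
      mxspace R m n => v a.1 a.2).
    exact: measurable_coord.
  apply: measurable_mx => i j; rewrite /f; under eq_fun do rewrite !mxE.
  case: eqP => _; first by apply: measurable_funD; apply: measurable_funM.
  case: eqP => _; last exact: (mc (i, j)).
  by apply: measurable_funB; apply: measurable_funM.
split => // E mE; pose J := pred2 p q.
rewrite (gaussian_merge mu_gauss J (measurable_preimage_set mf mE)).
rewrite (gaussian_merge mu_gauss J mE).
apply: eq_integral => v _.
pose A := [set z : R * R | E (set_entry p z.1 (set_entry q z.2 v))].
have mA : measurable A.
  apply: (@measurable_preimage_set _ _ _ (mxspace R m n) (fun z :
      R * R => set_entry p z.1 (set_entry q z.2 v))) => //.
  apply: measurable_mx => i j; under eq_fun do rewrite !mxE.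
  case: (_ == p); first exact: measurable_fst.
  by case: (_ == q); [exact: measurable_snd|exact: measurable_cst].
have Jp : J p by rewrite /J /= eqxx.
have Jq : J q by rewrite /J /= eqxx orbT.
have mergeE (y : 'M[R]_(m, n)) : merge J v y = set_entry p (y p.1 p.2) (set_entry q
    (y q.1 q.2) v).
  apply/matrixP => i j; rewrite !mxE /J /=.
  by case: eqP => [<-//|_]; case: eqP => [<-|].
have Ep (a : 'I_m * 'I_n) : (a.1, a.2) = a by rewrite -surjective_pairing.
have rotE (y : 'M[R]_(m, n)) : f (merge J v y) =
    set_entry p (c * y p.1 p.2 + t * y q.1 q.2) (set_entry q (c * y q.1 q.2 - t * y
        p.1 p.2) v).
  apply/matrixP => i j; rewrite !mxE !Ep Jp Jq; case: eqP => // ijp;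
      case: eqP => // ijq.
  by rewrite /J /= (introF eqP ijp) (introF eqP ijq).
transitivity (mu [set y | A (c * y p.1 p.2 + t * y q.1 q.2, c * y q.1 q.2 - t * y
    p.1 p.2)]).
  congr (mu _); apply/seteqP; split => y /=; by rewrite /A /= rotE.
pose A' := [set z : R * R | A (c * z.1 + t * z.2, c * z.2 - t * z.1)].
have mA' : measurable A'.
  apply: (@measurable_preimage_set _ _ _ _ (fun z :
      R * R => (c * z.1 + t * z.2, c * z.2 - t * z.1))) => //.
  apply: measurable_fun_pair.
    by apply: measurable_funD => //; apply: measurable_funM.
  by apply: measurable_funB => //; apply: measurable_funM.
apply: (etrans (gaussian_coord2 mu_gauss pq mA')).
rewrite (gaussR2_rotation s0 t0 ct1)//.
apply: (etrans (esym (gaussian_coord2 mu_gauss pq mA))).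
by congr (mu _); apply/seteqP; split => y /=; rewrite /A/= mergeE.
Qed.

Definition flip_entry (p : 'I_m * 'I_n) (v : mxspace R m n) : mxspace R m n :=
  set_entry p (- v p.1 p.2) v.

Lemma preserves_flip_entry (p : 'I_m * 'I_n) :
  preserves mu (flip_entry p).
Proof.
pose f := flip_entry p.
have mf : measurable_fun setT f.
  apply: measurable_mx => i j; rewrite /f; under eq_fun do rewrite !mxE.
  case: eqP => _; last exact: measurable_coord.
  by apply: measurable_funN; exact: measurable_coord.
split => // E mE; pose J := pred1 p.
rewrite (gaussian_merge mu_gauss J (measurable_preimage_set mf mE)).
rewrite (gaussian_merge mu_gauss J mE).
apply: eq_integral => v _.
pose A := [set z : R | E (set_entry p z v)].
have mA : measurable A.
  apply: (@measurable_preimage_set _ _ _ (mxspace R m n) (fun z :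
      R => set_entry p z v)) => //.
  apply: measurable_mx => i j; under eq_fun do rewrite !mxE.
  by case: (_ == p); [exact: measurable_id|exact: measurable_cst].
have mergeE (y : 'M[R]_(m, n)) : merge J v y = set_entry p (y p.1 p.2) v.
  by apply/matrixP => i j; rewrite !mxE /J /=; case: eqP => [<-|].
transitivity (mu [set y | (fun z => A (- z)) (y p.1 p.2)]).
  congr (mu _); apply/seteqP; split => y /=; rewrite /A /f /=;
    congr (E _); apply/matrixP => i j; rewrite !mxE /J -?surjective_pairing /= ?eqxx.
    by case: eqP.
  by case: eqP.
have mA' : measurable [set z | A (- z)] by apply: (@measurable_preimage_set _ _ _ _
    (-%R : R -> R)) => //; exact: oppr_measurable.
apply: (etrans (gaussian_coord mu_gauss p.1 p.2 mA')).
rewrite gaussRN//; apply: (etrans (esym (gaussian_coord mu_gauss p.1 p.2 mA))).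
by congr (mu _); apply/seteqP; split => y /=; rewrite /A/= mergeE.
Qed.

End law.
End preserves.

(** * Orthogonal invariance *)

Section orthogonal_invariance.
Context {R : realType} (s : R) (s0 : s != 0).

(** The rows are rotated one column at a time. *)
Lemma preserves_rotrows m n (mu : probability (mxspace R m n) R) (j k :
    'I_m) (c t : R) :
  gaussian_law s mu -> j != k -> t != 0 -> c ^+ 2 + t ^+ 2 = 1 ->
  preserves mu (rotrows j k c t predT : mxspace R m n -> mxspace R m n).
Proof.
move=> mug jk t0 ct1.
suff H (l : seq 'I_n) : uniq l ->
    preserves mu (rotrows j k c t (mem l) : mxspace R m n -> mxspace R m n).
  rewrite (_ : rotrows _ _ _ _ _ = rotrows j k c t (mem (enum 'I_n))); last first.
    by apply/funext => v; apply/matrixP => a b; rewrite !mxE/= mem_enum.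
  by apply: H; exact: enum_uniq.
elim: l => [_|h l IH /= /andP[hl ul]].
  rewrite (_ : rotrows _ _ _ _ _ = id); first exact: preserves_id.
  by apply/funext => v; apply/matrixP => a b; rewrite !mxE.
rewrite (_ : rotrows _ _ _ _ _ = rotate_entries (j, h) (k, h) c t \o rotrows j k c
    t (mem l)); last first.
  apply/funext => v; apply/matrixP => a b; rewrite !mxE/= (negbTE hl) !xpair_eqE
      in_cons.
  by have [->|bh] := eqVneq b h; rewrite ?andbT ?andbF//= (negbTE hl).
apply: preserves_comp; last exact: IH.
by apply: (preserves_rotate_entries s0 mug) => //; rewrite xpair_eqE eqxx andbT.
Qed.

Lemma preserves_rotation_product m n (mu : probability (mxspace R m n) R) (Q :
    'M[R]_m) :
  gaussian_law s mu -> rotation_product Q ->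
  preserves mu (mulmx Q : mxspace R m n -> mxspace R m n).
Proof.
move=> mug; elim=> [|j k c t P jk t0 ct1 _ IH].
  rewrite (_ : mulmx _ = id); first exact: preserves_id.
  by apply/funext => v; rewrite mul1mx.
rewrite (_ : mulmx _ = (rotrows j k c t predT) \o mulmx P).
  by apply: preserves_comp => //; exact: preserves_rotrows.
by apply/funext => v /=; rewrite -givensE mulmxA.
Qed.

Definition flip_rows m n (e : 'I_m -> bool) (l : pred ('I_m * 'I_n)) (v :
    'M[R]_(m, n)) : 'M[R]_(m, n) :=
  \matrix_(i, j) if l (i, j) then (-1) ^+ e i * v i j else v i j.

Lemma preserves_flip_rows m n (mu : probability (mxspace R m n) R) (e : 'I_m ->
    bool) :
  gaussian_law s mu ->
  preserves mu (flip_rows e predT : mxspace R m n -> mxspace R m n).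
Proof.
move=> mug.
suff H (l : seq ('I_m * 'I_n)) : uniq l ->
    preserves mu (flip_rows e (mem l) : mxspace R m n -> mxspace R m n).
  rewrite (_ : flip_rows _ _ = flip_rows e (mem (enum {: 'I_m * 'I_n}))); last first.
    by apply/funext => v; apply/matrixP => a b; rewrite !mxE/= mem_enum.
  by apply: H; exact: enum_uniq.
elim: l => [_|[h1 h2] l IH /= /andP[hl ul]].
  rewrite (_ : flip_rows _ _ = id); first exact: preserves_id.
  by apply/funext => v; apply/matrixP => a b; rewrite !mxE.
have [eh|eh] := boolP (e h1); last first.
  rewrite (_ : flip_rows _ _ = flip_rows e (mem l)); first exact: IH.
  apply/funext => v; apply/matrixP => a b; rewrite !mxE/= in_cons.
  by case: eqP => //= -[-> ->]; rewrite (negbTE hl) (negbTE eh) mul1r.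
rewrite (_ : flip_rows _ _ = flip_entry (h1, h2) \o flip_rows e (mem l)); last first.
  apply/funext => v; apply/matrixP => a b; rewrite !mxE/= in_cons (negbTE hl).
  by case: eqP => //= -[-> ->]; rewrite eh expr1 mulN1r.
apply: preserves_comp; last exact: IH.
exact: (preserves_flip_entry s0 mug).
Qed.

(** By induction on [i]: column [i] reduces to its diagonal entry, and
orthogonality of the other columns to it clears the rest of row [i]. *)
Lemma orth_triangular n (T : 'M[R]_n) : orthmx T ->
  (forall i j : 'I_n, (j < i)%N -> T i j = 0) ->
  exists e : 'I_n -> bool, forall i j, T i j = if i == j then (-1) ^+ e i else 0.
Proof.
move=> oT tri.
have dotE i j : \sum_k T k i * T k j = (i == j)%:R.
  have /matrixP/(_ i j) := oT; rewrite !mxE => <-.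
  by apply: eq_bigr => k _; rewrite mxE.
have H r : forall i j : 'I_n, (i < r)%N -> (T i i ^+ 2 = 1) /\ (j != i -> T i j = 0).
  elim: r => [//|r IH] i j; rewrite ltnS leq_eqVlt => /orP[/eqP ir|]; last exact: IH.
  have Ti (k : 'I_n) : k != i -> T k i = 0.
    rewrite -val_eqE neq_ltn => /orP[ki|ik]; last exact: tri.
    by have [_] := IH k i (leq_trans ki (eq_leq ir)); apply; rewrite -val_eqE gtn_eqF.
  have Tii : T i i ^+ 2 = 1.
    have := dotE i i; rewrite eqxx (bigD1 i)//= big1 ?addr0 ?expr2//.
    by move=> k ki; rewrite Ti// mul0r.
  split=> // ji; have := dotE i j; rewrite (bigD1 i)//= big1 ?addr0; last first.
    by move=> k ki; rewrite Ti// mul0r.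
  rewrite eq_sym (negbTE ji) => /eqP; rewrite mulf_eq0 => /orP[/eqP T0|/eqP//].
  by move: Tii; rewrite T0 expr0n/= => /eqP; rewrite eq_sym oner_eq0.
exists (fun i => T i i != 1) => i j; have [<-|ij] := eqVneq i j; last first.
  by have [_] := H n i j (ltn_ord i); apply; rewrite eq_sym.
have [/eqP + _] := H n i i (ltn_ord i); rewrite sqrf_eq1.
by case: eqVneq => //= _ /eqP ->; rewrite expr1.
Qed.

(** By the QR decomposition, [Q] is the inverse of a product of plane rotations
times a diagonal matrix of signs. *)
Lemma preserves_orthl m n (mu : probability (mxspace R m n) R) (Q : 'M[R]_m) :
  gaussian_law s mu -> orthmx Q -> preserves mu (mulmx Q : mxspace R m n ->
      mxspace R m n).
Proof.
move=> mug oQ; have [P rP Ptri] := qr_decomposition Q.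
have oP := rotation_product_orth rP.
have [e Te] := orth_triangular (orthmxM oP oQ) Ptri.
have [_ pS] := preserves_flip_rows e mug.
have [_ pP] := preserves_rotation_product mug rP.
have mM (M : 'M[R]_m) : measurable_fun setT (mulmx M : mxspace R m n ->
    mxspace R m n).
  exact: measurable_mulmxl.
split => // E mE; pose E' : set (mxspace R m n) := [set w | E (P^T *m w)].
have mE' : measurable E' by apply: (measurable_preimage_set (mM P^T)).
transitivity (mu E').
  rewrite -(pS E')//; congr (mu _); apply/seteqP; split => v; rewrite /E' /=;
    congr (E _); rewrite (_ : flip_rows _ _ _ = P *m Q *m v).
  - by rewrite -mulmxA mulmxA oP mul1mx.
  - apply/matrixP => i j; rewrite !mxE (bigD1 i)//= Te eqxx big1 ?addr0//.
    by move=> k ki; rewrite Te eq_sym (negbTE ki) mul0r.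
  - by rewrite -mulmxA mulmxA oP mul1mx.
  - apply/matrixP => i j; rewrite !mxE (bigD1 i)//= Te eqxx big1 ?addr0//.
    by move=> k ki; rewrite Te eq_sym (negbTE ki) mul0r.
rewrite -(pP E')//; congr (mu _).
by apply/seteqP; split => v; rewrite /E' /= mulmxA oP mul1mx.
Qed.

Lemma gaussian_law_tr m n (mu : probability (mxspace R m n) R) : gaussian_law s mu ->
  exists2 nu : probability (mxspace R n m) R, gaussian_law s nu &
    forall E : set (mxspace R n m), nu E = mu [set v | E v^T].
Proof.
move=> mug.
pose f (v : mxspace R m n) : mxspace R n m := v^T.
have mf : measurable_fun setT f by exact: measurable_trmx_id.
pose F : {mfun mxspace R m n >-> mxspace R n m} :=
  HB.pack f (isMeasurableFun.Build _ _ _ _ _ mf).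
exists (distribution mu F) => // B mB.
transitivity (mu (mxbox (fun p => B (p.2, p.1)))).
  congr (mu _); apply/seteqP; split => v /= h [i j] /=.
    by have := h (j, i); rewrite /= /f mxE.
  by rewrite /f mxE; exact: (h (j, i)).
rewrite mug//; pose h (p : 'I_n * 'I_m) := (p.2, p.1).
rewrite (reindex_onto h (fun p => (p.2, p.1)))/=; last by case.
by apply: eq_big => -[i j]; rewrite ?eqxx.
Qed.

Lemma preserves_orthr m n (mu : probability (mxspace R m n) R) (Q : 'M[R]_n) :
  gaussian_law s mu -> orthmx Q ->
  preserves mu ((fun v => v *m Q) : mxspace R m n -> mxspace R m n).
Proof.
move=> mug oQ; have [nu nug nuE] := gaussian_law_tr mug.
have [_ pQ] := preserves_orthl nug (orthmx_tr oQ).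
split=> [|E mE]; first exact: measurable_mulmxr.
pose E' : set (mxspace R n m) := [set w | E w^T].
have mE' : measurable E'.
  apply: (@measurable_preimage_set _ _ _ (mxspace R m n) (fun w :
      mxspace R n m => w^T)) => //.
  exact: measurable_trmx_id.
have := pQ _ mE'; rewrite !nuE /E' /= => h.
transitivity (mu [set v | E (Q^T *m v^T)^T]).
  by congr (mu _); apply/seteqP; split => v /=; rewrite trmx_mul !trmxK.
by rewrite h; congr (mu _); apply/seteqP; split => v /=; rewrite trmxK.
Qed.

(** The map [f] may depend on [v] in an arbitrary way: the integral over the
resampled entries is computed for each [v] separately. *)
Lemma measure_le_of_rotation m n (mu : probability (mxspace R m n) R) (J :
    pred ('I_m * 'I_n))
    (E1 E2 : set (mxspace R m n)) :
  gaussian_law s mu -> measurable E1 -> measurable E2 ->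
  (forall v, exists2 f : mxspace R m n -> mxspace R m n, preserves mu f &
     forall y, E1 (merge J v (f y)) -> E2 (merge J v y)) ->
  (mu E1 <= mu E2)%E.
Proof.
move=> mug mE1 mE2 H.
rewrite (gaussian_merge mug J mE1) (gaussian_merge mug J mE2).
have mF (E : set (mxspace R m n)) : measurable E ->
    measurable_fun setT (fun v : mxspace R m n => mu [set y | E (merge J v y)]).
  move=> mE; have mE' := measurable_preimage_set (measurable_merge J) mE.
  have := measurable_fun_xsection mu mE'.
  apply: eq_measurable_fun => v _ /=; congr (mu _).
  by apply/seteqP; split => y /=; rewrite xsectionE.
apply: ge0_le_integral => //; [exact: mF|exact: mF|].
move=> v _; have [f [mf pf] fE] := H v.
have mE1' : measurable ([set y | E1 (merge J v y)] : set (mxspace R m n)).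
  exact: (measurable_preimage_set (measurable_merge2 J v) mE1).
rewrite -(pf _ mE1'); apply: le_measure; rewrite ?inE//.
- exact: (measurable_preimage_set mf mE1').
- exact: (measurable_preimage_set (measurable_merge2 J v) mE2).
Qed.

End orthogonal_invariance.

(** * Spectral theorem, singular values and Gram matrices *)

Section linear_algebra.
Context {R : realType}.

Lemma sqnorm2E k (v : 'cV[R]_k) : sqnorm2 v = (v^T *m v) 0 0.
Proof. by rewrite mxE; apply: eq_bigr => i _; rewrite mxE expr2. Qed.

Lemma sqnorm2_orth k (Q : 'M[R]_k) v : orthmx Q -> sqnorm2 (Q *m v) = sqnorm2 v.
Proof. by move=> oQ; rewrite !sqnorm2E trmx_mul mulmxA -(mulmxA v^T) oQ mulmx1. Qed.

Lemma sqnorm2_eq0 k (v : 'cV[R]_k) : sqnorm2 v = 0 -> v = 0.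
Proof.
move/eqP; rewrite psumr_eq0 => [|i _]; last exact: sqr_ge0.
move=> /allP h; apply/matrixP => i j; rewrite ord1 mxE.
by have := h i (mem_index_enum i); rewrite sqrf_eq0 => /eqP.
Qed.

Lemma sqnorm2_ge0 k (v : 'cV[R]_k) : 0 <= sqnorm2 v.
Proof. by apply: sumr_ge0 => i _; exact: sqr_ge0. Qed.

Lemma gram_eq0 m n (G : 'M[R]_(m, n)) (v : 'cV[R]_n) : (G^T *m G) *m v = 0 ->
    G *m v = 0.
Proof.
move=> h; apply: sqnorm2_eq0.
by rewrite sqnorm2E trmx_mul mulmxA -(mulmxA v^T) -mulmxA h mulmx0 mxE.
Qed.

Lemma inj_unitmx n (M : 'M[R]_n) :
  (forall v : 'cV[R]_n, M *m v = 0 -> v = 0) -> M \in unitmx.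
Proof.
move=> h; rewrite -unitmx_tr -row_free_unit; apply: inj_row_free => v vM.
apply: trmx_inj; rewrite trmx0; apply: h.
by rewrite -[M]trmxK -trmx_mul vM trmx0.
Qed.

Lemma unitmx_mul_eq0 n p (M : 'M[R]_n) (v : 'M[R]_(n, p)) : M \in unitmx ->
    M *m v = 0 -> v = 0.
Proof. by move=> uM Mv; rewrite -[v](mulKmx uM) Mv mulmx0. Qed.

(** The matrix has an eigenvector [v] over the complex numbers; as
[v S v^*] is real, so is its eigenvalue, which is thus a root of the
characteristic polynomial over [R]. *)
Lemma sym_eigenvalue n (S : 'M[R]_n.+1) : S^T = S -> exists a : R, eigenvalue S a.
Proof.
move=> symS.
pose f : {rmorphism R -> R[i]} := real_complex R.
have [a /eigenvalueP[v vS v0]] := eigenvalue_closed (map_mx f S) (ltn0Sn n).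
pose w : 'rV[R[i]]_n.+1 := map_mx conjc v; pose Sc := map_mx f S.
have wS : map_mx conjc Sc = Sc.
  by apply/matrixP => i j; rewrite !mxE; exact: conjc_real.
have ww : map_mx conjc w = v by apply/matrixP => i j; rewrite !mxE conjcK.
pose c := v *m Sc *m w^T; pose N := v *m w^T.
have cN : c = a *: N by rewrite /c vS -scalemxAl.
(* The 1 x 1 matrix [c] is Hermitian because [S] is symmetric. *)
have cc : map_mx conjc c = c.
  have ScT : Sc^T = Sc by rewrite /Sc map_trmx symS.
  have cT : c^T = c by apply/matrixP => i j; rewrite !ord1 mxE.
  rewrite [LHS]map_mxM/= map_mxM/= -map_trmx ww wS -/w -cT /c !trmx_mul.
  by rewrite trmxK ScT mulmxA.
have N0 : N 0 0 != 0.
  rewrite mxE psumr_neq0 => [|i _]; last by rewrite !mxE; exact: mul_conjC_ge0.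
  case: (pickP (fun i => v 0 i != 0)) => [i vi|v00]; last first.
    by move: v0; rewrite (_ : v = 0) ?eqxx//; apply/rowP => i; rewrite mxE;
        move/negbFE/eqP: (v00 i).
  apply/hasP; exists i; rewrite ?mem_index_enum//= lt0r !mxE.
  by rewrite mul_conjC_ge0 mul_conjC_eq0 vi.
have NN : conjc (N 0 0) = N 0 0.
  rewrite /N !mxE rmorph_sum/=; apply: eq_bigr => i _.
  by rewrite !mxE rmorphM/= conjcK mulrC.
have aR : conjc a = a.
  have cN00 : c 0 0 = a * N 0 0 by rewrite cN mxE.
  have cc00 : conjc (c 0 0) = c 0 0 by rewrite -[in RHS]cc [RHS]mxE.
  by apply: (mulIf N0); rewrite -cN00 -[RHS]cc00 cN00 rmorphM/= NN.
exists (complex.Re a).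
rewrite eigenvalue_root_char -(fmorph_root f) map_char_poly.
rewrite (_ : f _ = a); last first.
  by case: (a) aR => x y /= -[] /eqP; rewrite eq_sym -addr_eq0 -mulr2n mulrn_eq0 =>
      /eqP ->.
by rewrite -eigenvalue_root_char; apply/eigenvalueP; exists v.
Qed.

(** A rotation takes a real eigenvector to a multiple of the first basis vector;
by symmetry the matrix then splits off a block of size one. *)
Lemma spectral_sym n (S : 'M[R]_n) : S^T = S ->
  exists2 U : 'M[R]_n, orthmx U & exists l : 'rV[R]_n, U^T *m S *m U = diag_mx l.
Proof.
elim: n S => [|n IH] S symS.
  exists 1%:M; first exact: orthmx1.
  by exists 0; apply/matrixP => -[].
have [a /eigenvalueP[u uS u0]] := sym_eigenvalue symS.
have [Q rQ Qtri] := qr_decomposition u^T.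
have oQ := rotation_product_orth rQ.
have [S1 S1def] : exists S1 : 'M[R]_(1 + n), S1 = Q *m S *m Q^T by eexists.
have symS1 : S1^T = S1 by rewrite S1def !trmx_mul trmxK symS mulmxA.
have [w wdef] : exists w, w = Q *m u^T by eexists.
have wtri k : w (lift 0 k) 0 = 0 by rewrite wdef; exact: Qtri.
have w0 : w 0 0 != 0.
  apply: contra u0 => /eqP w00; apply/eqP/trmx_inj; rewrite trmx0.
  rewrite -[u^T]mul1mx -oQ -mulmxA -wdef (_ : w = 0) ?mulmx0//.
  apply/matrixP => i j; rewrite ord1 mxE; case: (unliftP 0 i) => [k ->|->//].
  exact: wtri.
have S1w : S1 *m w = a *: w.
  rewrite wdef S1def !mulmxA -(mulmxA _ Q^T) oQ mulmx1 -mulmxA.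
  by rewrite -[S]symS -trmx_mul uS linearZ/= -scalemxAr.
have wE : w = w 0 0 *: delta_mx 0 0.
  apply/matrixP => i j; rewrite !ord1 !mxE eqxx andbT.
  by case: (unliftP 0 i) => [k ->|->]; rewrite ?mulr1// mulr0; exact: wtri.
have S1c (i : 'I_(1 + n)) : S1 i 0 = a * (i == 0)%:R.
  move: S1w; rewrite wE -scalemxAr scalerA mulrC -scalerA => /(scalerI w0).
  move=> /matrixP/(_ i 0); rewrite !mxE (bigD1 0)//= big1 => [|j j0].
    by rewrite !mxE !eqxx mulr1 addr0 andbT.
  by rewrite !mxE (negbTE j0) mulr0.
pose S2 := drsubmx S1.
have S1E : S1 = block_mx a%:M 0 0 S2.
  rewrite -[S1]submxK; congr block_mx.
  - by apply/matrixP => i j; rewrite !ord1 !mxE !lshift0 S1c eqxx mulr1.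
  - apply/matrixP => i j; rewrite -symS1 !ord1 !mxE lshift0.
    by rewrite [LHS](S1c (rshift 1 j)) mulr0.
  - by apply/matrixP => i j; rewrite !ord1 !mxE lshift0 S1c mulr0.
have symS2 : S2^T = S2 by rewrite /S2 trmx_drsub symS1.
have [U oU [l lE]] := IH S2 symS2.
pose B : 'M[R]_(1 + n) := block_mx 1%:M 0 0 U.
have oB : orthmx B.
  rewrite /orthmx /B tr_block_mx mulmx_block !trmx0 trmx1 !mul0mx !mulmx0 !mul1mx oU.
  by rewrite !addr0 add0r -scalar_mx_block.
exists (Q^T *m B : 'M[R]_n.+1); first by apply: orthmxM => //; exact: orthmx_tr.
exists (row_mx a%:M l : 'rV[R]_(1 + n)).
have -> : (Q^T *m B)^T *m S *m (Q^T *m B) = B^T *m S1 *m B.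
  by rewrite S1def trmx_mul trmxK !mulmxA.
rewrite S1E /B tr_block_mx !mulmx_block !trmx0 trmx1 !mul0mx !mulmx0 !mul1mx !mulmx1.
rewrite ?addr0 ?add0r ?mul0mx ?mulmx0 ?mulmx1 ?addr0 ?add0r lE.
rewrite [a%:M in LHS](_ : _ = diag_mx (a%:M : 'rV[R]_1)); last first.
  by apply/matrixP => i j; rewrite !ord1 !mxE.
exact: (esym (@diag_mx_row R n 1 a%:M l)).
Qed.

(** By induction on [k]: column [k] is a nonzero multiple of the basis vector
of index [k], and orthogonality to it clears the rest of row [k]. *)
Lemma triangular_orthogonal_columns m n (T : 'M[R]_(m, n)) :
  (forall (i : 'I_m) (j : 'I_n), (j < i)%N -> T i j = 0) ->
  (forall i j : 'I_n, i != j -> (T^T *m T) i j = 0) ->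
  (forall i : 'I_n, (T^T *m T) i i != 0) ->
  forall (k : 'I_m) (j : 'I_n), (k != j :> nat) -> T k j = 0.
Proof.
move=> tri off diag.
have dotE i j : (T^T *m T) i j = \sum_k T k i * T k j.
  by rewrite mxE; apply: eq_bigr => k _; rewrite mxE.
have H r : forall (k : 'I_m) (j : 'I_n), (k < r)%N -> (k < j)%N -> T k j = 0.
  elim: r => [//|r IH] k j; rewrite ltnS leq_eqVlt => /orP[/eqP kr|]; last exact: IH.
  move=> kj; pose k' := Ordinal (ltn_trans kj (ltn_ord j)).
  have Tk' (i : 'I_m) : i != k -> T i k' = 0.
    rewrite -val_eqE neq_ltn => /orP[ik|ki]; last exact: tri.
    by apply: IH => //; rewrite -kr.
  have sumE l : (T^T *m T) k' l = T k k' * T k l.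
    rewrite dotE (bigD1 k)//= big1 ?addr0// => i ik.
    by rewrite Tk' ?mul0r.
  have := diag k'; rewrite sumE mulf_eq0 orbb => Tkk.
  have k'j : k' != j by rewrite -val_eqE /= ltn_eqF.
  by have := off _ _ k'j; rewrite sumE => /eqP; rewrite mulf_eq0 (negbTE Tkk) => /eqP.
by move=> k j; rewrite neq_ltn => /orP[kj|]; [exact: (H m)|exact: tri].
Qed.

(** The singular value decomposition of [B]: [B] and [B^T] have the same
nonzero singular values, whence the same coefficients in both quadratic forms. *)
Lemma same_singular_values d q (B : 'M[R]_(d + q, d)) : B^T *m B \in unitmx ->
  exists P : 'M[R]_(d + q), exists U : 'M[R]_d, exists l : 'I_d -> R,
  [/\ orthmx P, orthmx U,
    forall g : 'cV[R]_(d + q), sqnorm2 (B^T *m (P *m g)) = \sum_i l i * usubmx g i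
        0 ^+ 2 &
    forall z : 'cV[R]_d, sqnorm2 (B *m (U *m z)) = \sum_i l i * z i 0 ^+ 2].
Proof.
move=> uB.
have symB : (B^T *m B)^T = B^T *m B by rewrite trmx_mul trmxK.
have [U oU [l lE]] := spectral_sym symB.
have [P rP tri] := qr_decomposition (B *m U).
have oP := rotation_product_orth rP.
have [T Tdef] : exists T, T = P *m (B *m U) by eexists.
rewrite -Tdef in tri.
have TT : T^T *m T = diag_mx l.
  by rewrite Tdef !trmx_mul -lE !mulmxA -(mulmxA _ P^T) oP mulmx1.
have diag0 i : (T^T *m T) i i != 0.
  have : T^T *m T \in unitmx.
    rewrite TT -lE !unitmx_mul uB unitmx_tr andbT.
    by have [_ ->] := mulmx1_unit oU.
  rewrite TT unitmxE det_diag unitfE => /prodf_neq0/(_ i isT).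
  by rewrite mxE eqxx.
have off i j : i != j -> (T^T *m T) i j = 0.
  by move=> ij; rewrite TT mxE (negbTE ij).
have Tdiag := triangular_orthogonal_columns tri off diag0.
exists P^T, U, (fun i => T (lshift q i) i ^+ 2); split=> //.
- exact: orthmx_tr.
- move=> g.
  have -> : sqnorm2 (B^T *m (P^T *m g)) = sqnorm2 (T^T *m g).
    rewrite -(sqnorm2_orth _ (orthmx_tr oU)) Tdef !trmx_mul.
    by rewrite !mulmxA.
  apply: eq_bigr => i _; rewrite !mxE (bigD1 (lshift q i))//= big1 => [|k ki].
    by rewrite addr0 !mxE exprMn.
  by rewrite mxE Tdiag ?mul0r//.
- move=> z.
  have -> : sqnorm2 (B *m (U *m z)) = sqnorm2 (T *m z).
    by rewrite Tdef -mulmxA sqnorm2_orth// mulmxA.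
  rewrite /sqnorm2 big_split_ord/= [X in _ + X]big1 ?addr0 => [|i _]; last first.
    rewrite mxE big1 ?expr0n// => j _; rewrite Tdiag ?mul0r//=.
    by rewrite gtn_eqF// (leq_trans (ltn_ord j))// leq_addr.
  apply: eq_bigr => i _; rewrite mxE (bigD1 i)//= big1 => [|j ji].
    by rewrite addr0 exprMn.
  by rewrite Tdiag ?mul0r//= eq_sym.
Qed.

Lemma rotate_to_first e (z : 'cV[R]_e.+1) :
  exists2 P : 'M[R]_e.+1, orthmx P &
    exists2 r : R, r ^+ 2 = sqnorm2 z & P *m z = r *: delta_mx 0 0.
Proof.
have [P rP tri] := qr_decomposition z.
have oP := rotation_product_orth rP.
have [w wdef] : exists w, w = P *m z by eexists.
have wE : w = w 0 0 *: delta_mx 0 0.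
  apply/matrixP => i j; rewrite !ord1 !mxE eqxx andbT.
  case: (unliftP 0 i) => [k ->|->]; rewrite ?mulr1// mulr0 wdef; exact: tri.
have nw : sqnorm2 z = w 0 0 ^+ 2.
  rewrite -(sqnorm2_orth _ oP) -wdef wE /sqnorm2 big_ord_recl big1 => [|i _].
    by rewrite !mxE !eqxx mulr1 addr0.
  by rewrite !mxE/= mulr0 expr0n.
by exists P => //; exists (w 0 0); rewrite -?wdef.
Qed.

(** The solution [y] of W y = e_0 has first coordinate (W^-1)_00, and N y is
the vector of the column space orthogonal to all columns but the first, hence a
multiple of the component of the first column that is orthogonal to the others. *)
Lemma gram_inv_first_block q e (a : 'cV[R]_(e + q)) (T : 'M[R]_e) (N :
    'M[R]_(e + q, 1 + e)) :
  N = row_mx a (col_mx T 0) -> N^T *m N \in unitmx ->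
  invmx (N^T *m N) 0 0 * sqnorm2 (dsubmx a) = 1.
Proof.
move=> NE uN; set W := N^T *m N in uN *.
have uT : T^T \in unitmx.
  rewrite unitmx_tr; apply: inj_unitmx => v Tv.
  have : N *m col_mx (0 : 'cV_1) v = 0.
    by rewrite NE mul_row_col mulmx0 add0r mul_col_mx Tv mul0mx col_mx0.
  move=> Nv; have := unitmx_mul_eq0 uN (_ : W *m col_mx (0 : 'cV_1) v = 0).
  rewrite -mulmxA Nv mulmx0 => /(_ erefl) /(congr1 (@dsubmx _ _ _ _)).
  by rewrite col_mxKd => ->; apply/matrixP => i j; rewrite !mxE.
have [y ydef] : exists y, y = invmx W *m (delta_mx 0 0 : 'cV[R]_(1 + e)) by eexists.
have y0 : invmx W 0 0 = y 0 0.
  rewrite ydef mxE (bigD1 0)//= big1 ?addr0 => [|j j0]; rewrite !mxE ?eqxx ?mulr1//.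
  by rewrite (negbTE j0) mulr0.
pose r := N *m y.
have Nr : N^T *m r = delta_mx 0 0 by rewrite /r mulmxA ydef mulKVmx.
have rE : r = y 0 0 *: a + col_mx T 0 *m dsubmx y.
  rewrite /r NE -[y in LHS]vsubmxK mul_row_col; congr (_ + _).
  apply/matrixP => i j; rewrite !ord1 mxE big_ord1 !mxE mulrC; congr (y _ _ * _).
  exact: val_inj.
have Tr0 : usubmx r = 0.
  apply: (unitmx_mul_eq0 uT).
  have := congr1 (@dsubmx _ 1 e 1) Nr.
  rewrite NE tr_row_mx mul_col_mx col_mxKd tr_col_mx trmx0 -[r in X in X ->
      _]vsubmxK mul_row_col mul0mx addr0 => ->.
  by apply/matrixP => i j; rewrite !mxE; case: eqP => // /(congr1 val).
have dr : dsubmx r = y 0 0 *: dsubmx a.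
  by rewrite rE linearD/= mul_col_mx mul0mx linearZ/= col_mxKd addr0.
have := congr1 (fun M => usubmx M 0 0) Nr.
rewrite NE tr_row_mx mul_col_mx col_mxKu -[r]vsubmxK Tr0 dr -[a in a^T]vsubmxK.
rewrite tr_col_mx mul_row_col mulmx0 add0r -scalemxAr mxE -sqnorm2E y0 => ->.
by rewrite !mxE.
Qed.


Lemma gram_inv_first m e (N : 'M[R]_(m, e.+1)) : (e <= m)%N ->
  (forall (i : 'I_m) (j : 'I_e), (e <= i)%N -> N i (lift 0 j) = 0) ->
  N^T *m N \in unitmx ->
  invmx (N^T *m N) 0 0 * (\sum_(i < m | (e <= i)%N) N i 0 ^+ 2) = 1.
Proof.
move=> em; have [q mE] : exists q, m = (e + q)%N by exists (m - e)%N; rewrite subnKC.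
subst m => N0 uN.
pose N1 : 'M[R]_(e + q, 1 + e) := N.
have h : rsubmx N1 = col_mx (usubmx (rsubmx N1)) 0.
  rewrite -[LHS]vsubmxK; congr col_mx.
  apply/matrixP => i j; rewrite !mxE (_ : rshift 1 j = lift 0 j); last exact: val_inj.
  by apply: N0; rewrite /= leq_addr.
have NE : N1 = row_mx (lsubmx N1) (col_mx (usubmx (rsubmx N1)) 0) by rewrite -h
    hsubmxK.
have := gram_inv_first_block NE uN; rewrite /sqnorm2 => <-; congr (_ * _).
rewrite big_split_ord/= [X in X + _]big1 ?add0r => [|i];
    last by rewrite leqNgt ltn_ord.
apply: eq_big => [i|i _]; first by rewrite leq_addr.
by rewrite !mxE; congr (N _ _ ^+ 2); exact: val_inj.
Qed.

End linear_algebra.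

(** * The excess risk of sketched least squares *)

Section least_squares.
Context {R : realType}.

Lemma sqnorm2N k (v : 'cV[R]_k) : sqnorm2 (- v) = sqnorm2 v.
Proof. by apply: eq_bigr => i _; rewrite mxE sqrrN. Qed.

Lemma sqnorm2Z k (a : R) (v : 'cV[R]_k) : sqnorm2 (a *: v) = a ^+ 2 * sqnorm2 v.
Proof. by rewrite /sqnorm2 mulr_sumr; apply: eq_bigr => i _; rewrite mxE exprMn. Qed.

Lemma sqnorm2D k (u v : 'cV[R]_k) :
  sqnorm2 (u + v) = sqnorm2 u + 2 * (u^T *m v) 0 0 + sqnorm2 v.
Proof.
rewrite mxE /sqnorm2 mulr_sumr -!big_split/=; apply: eq_bigr => i _.
by rewrite !mxE; ring.
Qed.

Lemma sqnorm2_col k l (u : 'cV[R]_k) (v : 'cV[R]_l) :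
  sqnorm2 (col_mx u v) = sqnorm2 u + sqnorm2 v.
Proof.
rewrite /sqnorm2 big_split_ord/=; congr (_ + _); apply: eq_bigr => i _.
  by rewrite col_mxEu.
by rewrite col_mxEd.
Qed.

(** Otherwise a small step along the opposite of the gradient would decrease the
    objective. *)
Lemma argmin_normal_equation k d (A : 'M[R]_(k, d)) b x :
  argmin (lsq A b) x -> A^T *m (A *m x - b) = 0.
Proof.
move=> xmin; have [r rE] : exists r, r = A *m x - b by eexists.
rewrite -rE; have [h hE] : exists h, h = A^T *m r by eexists.
rewrite -hE.
pose N := sqnorm2 h; pose M := sqnorm2 (A *m h).
have M0 : 0 < M + 1 by rewrite ltr_wpDl// sqnorm2_ge0.
suff N0 : N = 0 by exact: sqnorm2_eq0.
(* [M + 1] instead of [M] avoids a division by zero. *)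
have := xmin (x - (N / (M + 1)) *: h); rewrite /lsq -rE.
rewrite (_ : A *m (x - _) - b = r + (- (N / (M + 1))) *: (A *m h)); last first.
  by rewrite mulmxBr -scalemxAr scaleNr rE addrAC.
rewrite sqnorm2D sqnorm2Z -scalemxAr mulmxA.
rewrite (_ : r^T *m A = h^T); last by rewrite hE trmx_mul trmxK.
rewrite [X in 2 * X]mxE -sqnorm2E -/N -/M => h1.
have h2 : 0 <= N / (M + 1) * (- (2 * N) + (N / (M + 1)) * M) by move: h1; nra.
have h3 : N / (M + 1) * (- (2 * N) + (N / (M + 1)) * M) = - (N ^+ 2 * ((M + 2) / (M
    + 1) ^+ 2)).
  by field; rewrite gt_eqF.
move: h2; rewrite h3 oppr_ge0 => h4; apply/eqP; rewrite -sqrf_eq0.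
have c0 : 0 < (M + 2) / (M + 1) ^+ 2.
  by rewrite divr_gt0 ?exprn_gt0// ltr_wpDl// sqnorm2_ge0.
by rewrite eq_le sqr_ge0 andbT; move: h4; rewrite pmulr_lle0.
Qed.

Lemma unique_argmin_inj k d (A : 'M[R]_(k, d)) b x : argmin (lsq A b) = [set x] ->
  forall y : 'cV[R]_d, A *m y = 0 -> y = 0.
Proof.
move=> xmin y Ay; have : argmin (lsq A b) (x + y).
  have : argmin (lsq A b) x by rewrite xmin.
  by move=> h z; rewrite /lsq mulmxDr Ay addr0; exact: h.
by rewrite xmin /= => /(canRL (addKr _)); rewrite addNr.
Qed.

(** The columns of [A] and the residual, which is nonzero and orthogonal to
them, are linearly independent. *)
Lemma overdetermined k d (A : 'M[R]_(k, d)) b x :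
  argmin (lsq A b) = [set x] -> lsq A b x != 0 -> (d < k)%N.
Proof.
rewrite /lsq => xmin; have [r rE] : exists r, r = A *m x - b by eexists.
rewrite -rE => r0.
have Ar : A^T *m r = 0 by rewrite rE; apply: argmin_normal_equation; rewrite xmin.
have rA : r^T *m A = 0 by rewrite -[A]trmxK -trmx_mul Ar trmx0.
have : row_free (row_mx A r)^T.
  apply: inj_row_free => v; rewrite -[v]trmxK -trmx_mul => /(congr1 trmx).
  rewrite !trmxK trmx0 -[v^T]vsubmxK mul_row_col => h.
  have ry : r^T *m r *m dsubmx v^T = 0.
    have := congr1 (mulmx r^T) h; rewrite mulmxDr mulmx0 !mulmxA.
    by rewrite rA mul0mx add0r.
  have y0 : dsubmx v^T = 0.
    apply/matrixP => i j; rewrite !ord1 [RHS]mxE.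
    have /eqP := congr1 (fun M : 'cV[R]_1 => M 0 0) ry.
    rewrite [X in X == _]mxE big_ord1 -sqnorm2E [X in _ == X]mxE.
    by rewrite mulf_eq0 (negbTE r0) => /eqP.
  move: h; rewrite y0 mulmx0 addr0 => /(unique_argmin_inj xmin) u0.
  by rewrite -[v]trmxK -[v^T]vsubmxK u0 y0 col_mx0 trmx0.
rewrite /row_free => /eqP; have := rank_leq_col (row_mx A r)^T.
by move=> /[swap] ->; rewrite addn1.
Qed.

Lemma least_squares_normal_form d k (A : 'M[R]_(d + (1 + k), d)) b x :
  argmin (lsq A b) = [set x] ->
  exists2 Q : 'M[R]_(d + (1 + k)), orthmx Q &
  exists2 T : 'M[R]_d, T \in unitmx &
  exists rho : R, Q *m A = col_mx T 0 /\
    Q *m (A *m x - b) = col_mx 0 (col_mx rho%:M 0).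
Proof.
move=> xmin; have [r rE] : exists r, r = A *m x - b by eexists.
rewrite -rE.
have Ar : A^T *m r = 0 by rewrite rE; apply: argmin_normal_equation; rewrite xmin.
have [Q rQ tri] := qr_decomposition (row_mx A r).
have oQ := rotation_product_orth rQ.
rewrite mul_mx_row in tri.
have [QA QAdef] : exists QA, QA = Q *m A by eexists.
have [Qr Qrdef] : exists Qr, Qr = Q *m r by eexists.
rewrite -QAdef -Qrdef in tri.
have dQA : dsubmx QA = 0.
  apply/matrixP => i j; rewrite !mxE.
  have := tri (rshift d i) (lshift 1 j); rewrite row_mxEl; apply.
  by rewrite /= (leq_trans (ltn_ord j))// leq_addr.
have dQr : dsubmx (dsubmx Qr) = 0.
  apply/matrixP => i j; rewrite !mxE !ord1.
  have := tri (rshift d (rshift 1 i)) (rshift d 0); rewrite row_mxEr; apply.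
  by rewrite /= ltn_add2l.
pose T := usubmx QA.
have QAE : QA = col_mx T 0 by rewrite -dQA vsubmxK.
have uT : T \in unitmx.
  apply: inj_unitmx => v Tv; apply: (unique_argmin_inj xmin).
  rewrite -[A *m v]mul1mx -oQ -mulmxA (mulmxA Q) -QAdef QAE mul_col_mx Tv mul0mx.
  by rewrite col_mx0 mulmx0.
have c0 : usubmx Qr = 0.
  have uT' : T^T \in unitmx by rewrite unitmx_tr.
  apply: (unitmx_mul_eq0 uT').
  have : QA^T *m Qr = 0 by rewrite QAdef Qrdef trmx_mul mulmxA -(mulmxA A^T) oQ
      mulmx1.
  by rewrite QAE tr_col_mx -[Qr in X in X -> _]vsubmxK mul_row_col trmx0 mul0mx addr0.
exists Q => //; exists T => //; exists (dsubmx Qr 0 0); split;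
    first by rewrite -QAdef.
rewrite -Qrdef -[LHS]vsubmxK c0; congr col_mx; rewrite -[LHS]vsubmxK dQr;
    congr col_mx.
apply/matrixP => i j; rewrite !ord1 !mxE mulr1n; congr (Qr _ _); exact: val_inj.
Qed.

Lemma sketched_ratio m d k (A : 'M[R]_(d + (1 + k), d)) b x (Q : 'M[R]_(d + (1 + k)))
    (T : 'M[R]_d) (rho : R) (S : 'M[R]_(m, d + (1 + k))) (y : 'cV[R]_d) :
  orthmx Q -> T \in unitmx -> lsq A b x != 0 ->
  Q *m A = col_mx T 0 -> Q *m (A *m x - b) = col_mx 0 (col_mx rho%:M 0) ->
  argmin (lsq (S *m A) (S *m b)) y ->
  let S' := S *m Q^T in let G := lsubmx S' in let g := lsubmx (rsubmx S') in
  G^T *m G \in unitmx ->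
  lsq A b y / lsq A b x - 1 = sqnorm2 (invmx (G^T *m G) *m G^T *m g).
Proof.
move=> oQ uT r0 QA Qr ymin S' G g uW.
have [r rE] : exists r, r = A *m x - b by eexists.
have [h hE] : exists h, h = y - x by eexists.
rewrite -rE in Qr.
have lsqx : lsq A b x = rho ^+ 2.
  rewrite /lsq -rE -(sqnorm2_orth _ oQ) Qr !sqnorm2_col.
  have sq0 l : sqnorm2 (0 : 'cV[R]_l) = 0 by rewrite /sqnorm2 big1// => i _;
      rewrite mxE expr0n.
  by rewrite !sq0 add0r addr0 /sqnorm2 big_ord1 mxE mulr1n.
have rho0 : rho != 0 by rewrite -sqrf_eq0 -lsqx.
have lsqy : lsq A b y = sqnorm2 (T *m h) + rho ^+ 2.
  rewrite /lsq (_ : A *m y - b = A *m h + r); last first.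
    by rewrite hE mulmxBr rE addrA subrK.
  rewrite -(sqnorm2_orth _ oQ) mulmxDr mulmxA QA Qr mul_col_mx mul0mx add_col_mx
      addr0 add0r.
  rewrite !sqnorm2_col (_ : sqnorm2 (0 : 'cV[R]_k) = 0) ?addr0; last first.
    by rewrite /sqnorm2 big1// => i _; rewrite mxE expr0n.
  by congr (_ + _); rewrite /sqnorm2 big_ord1 mxE mulr1n.
have SE : S = S' *m Q by rewrite /S' -mulmxA oQ mulmx1.
have SA : S *m A = G *m T.
  by rewrite SE -mulmxA QA -[S']hsubmxK mul_row_col mulmx0 addr0.
have Sr : S *m r = rho *: g.
  rewrite SE -mulmxA Qr -[S']hsubmxK mul_row_col mulmx0 add0r.
  rewrite -[rsubmx S']hsubmxK mul_row_col mulmx0 addr0.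
  by rewrite mul_mx_scalar -/g.
have := argmin_normal_equation ymin.
rewrite (_ : S *m A *m y - S *m b = G *m (T *m h) + rho *: g); last first.
  by rewrite mulmxA -SA -Sr hE rE !mulmxBr !mulmxA addrA subrK.
have uT' : T^T \in unitmx by rewrite unitmx_tr.
rewrite SA trmx_mul -(mulmxA T^T) => /(unitmx_mul_eq0 uT').
rewrite mulmxDr !mulmxA => /eqP.
rewrite addr_eq0 => /eqP WTh.
have Th : T *m h = - (rho *: (invmx (G^T *m G) *m G^T *m g)).
  rewrite -[LHS](mulKmx uW) !mulmxA.
  move: (congr1 (mulmx (invmx (G^T *m G))) WTh); rewrite !mulmxA => ->.
  by rewrite mulmxN -scalemxAr -scalemxAr mulmxA.
rewrite lsqy lsqx Th sqnorm2N sqnorm2Z.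
by field.
Qed.

End least_squares.

(** * Nonsingularity and chi-square tails *)

Section measurability.
Context {R : realType} d (T : measurableType d).

Lemma measurable_funV (f : T -> R) : measurable_fun setT f ->
  measurable_fun setT (fun t => (f t)^-1).
Proof.
move=> mf; rewrite (_ : (fun t => _) = (fun t => f t * powR (f t ^+ 2) (- 1)));
    last first.
  apply/funext => t; rewrite powR_inv1 ?sqr_ge0//.
  have [->|f0] := eqVneq (f t) 0; first by rewrite invr0 mul0r.
  by field.
apply: measurable_funM => //.
apply: (@measurableT_comp _ _ _ _ _ _ (fun x : R => powR x (- 1))) => //.
  by apply: measurable_funX.
Qed.

Lemma measurable_det n (f : T -> mxspace R n n) : measurable_fun setT f ->
  measurable_fun setT (fun t => \det (f t)).
Proof.
move=> mf; rewrite /determinant; apply: measurable_sum => s.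
apply: measurable_funM; first exact: measurable_cst.
by apply: measurable_prod => i _; exact: (measurable_mxcomp _ _ mf).
Qed.

Lemma measurable_unitmx n (f : T -> mxspace R n n) : measurable_fun setT f ->
  measurable [set t | f t \in unitmx].
Proof.
move=> /measurable_det mf.
rewrite (_ : [set t | _] = (fun t => \det (f t)) @^-1` [set~ 0]).
  by rewrite -[X in measurable X]setTI; apply: mf => //; exact: measurableC.
by apply/seteqP; split => t /=; rewrite unitmxE unitfE => /eqP.
Qed.

Lemma measurable_invmx n (f : T -> mxspace R n n) : measurable_fun setT f ->
  measurable_fun setT (fun t => invmx (f t) : mxspace R n n).
Proof.
move=> mf; apply: measurable_mx => i j.
rewrite (_ : (fun t => _) = (fun t => if f t \in unitmx
   then (\det (f t))^-1 * ((-1) ^+ (j + i) * \det (row' j (col' i (f t)))) else f t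
       i j)).
  apply: measurable_fun_ifT => /=.
  - apply: (@measurable_fun_bool _ _ _ _ true); rewrite setTI.
    exact: measurable_unitmx.
  - apply: measurable_funM; first by apply: measurable_funV; exact: measurable_det.
    apply: measurable_funM; first exact: measurable_cst.
    apply: (@measurable_det _ (fun t => row' j (col' i (f t)))).
    apply: measurable_mx => a b; under eq_fun do rewrite !mxE.
    exact: (measurable_mxcomp _ _ mf).
  - exact: (measurable_mxcomp _ _ mf).
apply/funext => t; rewrite /invmx; case: ifP => // _; by rewrite !mxE.
Qed.

Lemma measurable_sqnorm2 n (f : T -> mxspace R n 1) : measurable_fun setT f ->
  measurable_fun setT (fun t => sqnorm2 (f t)).
Proof.
move=> mf; apply: measurable_sum => i; apply: measurable_funX.
exact: (measurable_mxcomp _ _ mf).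
Qed.

End measurability.

Section nonsingular.
Context {R : realType} (s : R).

(** The determinant is affine in its last entry, with slope the leading principal
    minor. *)
Lemma det_update_last r (A B : 'M[R]_r.+1) :
  (forall i j, (i != ord_max) || (j != ord_max) -> A i j = B i j) ->
  \det A - \det B =
  (A ord_max ord_max - B ord_max ord_max) * \det (row' ord_max (col' ord_max B)).
Proof.
move=> AB; rewrite !(expand_det_row _ ord_max) -sumrB.
have cof j : cofactor A ord_max j = cofactor B ord_max j.
  congr (_ * \det _); apply/matrixP => a b; rewrite !mxE; apply: AB.
  by rewrite eq_sym neq_lift.
rewrite (bigD1 ord_max)//= big1 ?addr0 => [|j jm].
  by rewrite cof -mulrBl /cofactor addnn -mul2n exprM sqrrN expr1n expr1n mul1r.
by rewrite cof AB ?subrr// jm orbT.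
Qed.

Definition leading_block m n r (rm : (r <= m)%N) (rn : (r <= n)%N) (v :
    'M[R]_(m, n)) : 'M[R]_r :=
  \matrix_(i, j) v (widen_ord rm i) (widen_ord rn j).

Lemma measurable_leading_block m n r (rm : (r <= m)%N) (rn : (r <= n)%N) :
  measurable_fun setT (leading_block rm rn : mxspace R m n -> mxspace R r r).
Proof.
apply: measurable_mx => i j; rewrite /leading_block; under eq_fun do rewrite mxE.
exact: measurable_coord.
Qed.

(** If the minor of size [r] does not vanish, then the minor of size [r.+1]
vanishes for at most one value of the last entry, the other entries being fixed. *)
Lemma gaussian_nonsingular m n (mu : probability (mxspace R m n) R)
    r (rm : (r <= m)%N) (rn : (r <= n)%N) : gaussian_law s mu ->
  mu [set v | \det (leading_block rm rn v) = 0] = 0%E.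
Proof.
move=> mug; elim: r rm rn => [|r IH] rm rn.
  rewrite (_ : [set v | _] = set0) ?measure0//.
  by apply/seteqP; split => v //=; rewrite det_mx00 => /eqP; rewrite oner_eq0.
have mD t (tm : (t <= m)%N) (tn : (t <= n)%N) :
    measurable_fun setT (fun v : mxspace R m n => \det (leading_block tm tn v)).
  by apply: measurable_det; exact: measurable_leading_block.
have mZ t (tm : (t <= m)%N) (tn : (t <= n)%N) :
    measurable ([set v | \det (leading_block tm tn v) = 0] : set (mxspace R m n)).
  rewrite (_ : [set v | _] = (fun v : mxspace R m n => \det (leading_block tm tn
      v)) @^-1` [set 0])//.
  by rewrite -[X in measurable X]setTI; exact: mD.
pose Z1 : set (mxspace R m n) := [set v | \det (leading_block (ltnW rm) (ltnW rn)
    v) = 0].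
pose Z2 : set (mxspace R m n) := [set v | \det (leading_block rm rn v) = 0].
have mZ1 : measurable Z1 by exact: mZ.
have mZ2 : measurable Z2 by exact: mZ.
pose i0 : 'I_m := Ordinal rm; pose j0 : 'I_n := Ordinal rn; pose p := (i0, j0).
suff Z0 : mu (Z2 `\` Z1) = 0%E.
  apply/eqP; rewrite eq_le measure_ge0 andbT.
  apply: (@le_trans _ _ (mu (Z1 `|` (Z2 `\` Z1)))).
    apply: le_measure; rewrite ?inE//; first by apply: measurableU => //;
        exact: measurableD.
    by move=> v Zv; have [|] := pselect (Z1 v); [left|right].
  have mD12 : measurable (Z2 `\` Z1) by exact: measurableD.
  have U : (mu (Z1 `|` (Z2 `\` Z1)) <= mu Z1 + mu (Z2 `\` Z1))%E by exact: measureU2.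
  by apply: (le_trans U); rewrite Z0 adde0 /Z1 IH.
rewrite (gaussian_merge mug (pred1 p)); last exact: measurableD.
apply: integral0_eq => v _.
set E := (X in mu X).
have mE : measurable (E : set (mxspace R m n)).
  apply: (measurable_preimage_set (measurable_merge2 (pred1 p) v));
      exact: measurableD.
have [[y0 y0E]|noE] := pselect (exists y, E y); last first.
  by rewrite (_ : E = set0) ?measure0//; apply/seteqP; split => y //= Ey;
      apply: noE; exists y.
apply/eqP; rewrite eq_le measure_ge0 andbT.
rewrite -(gaussR_set1 s (y0 i0 j0)) -(gaussian_coord mug i0 j0);
    last exact: measurable_set1.
apply: le_measure; rewrite ?inE//.
  by apply: (measurable_preimage_set (measurable_coord i0 j0));
      exact: measurable_set1.
move=> y [] /=; rewrite /Z2 /Z1 /= => Zy nZy.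
have [Zy0 nZy0] := y0E.
have wi (t : 'I_r.+1) : (widen_ord rm t == i0) = (t == ord_max) by rewrite -!val_eqE.
have wj (t : 'I_r.+1) : (widen_ord rn t == j0) = (t == ord_max) by rewrite -!val_eqE.
have leadE w : leading_block rm rn (merge (pred1 p) v w) ord_max ord_max = w i0 j0.
  rewrite !mxE /= xpair_eqE wi wj eqxx /=; congr (w _ _); exact: val_inj.
have := @det_update_last r (leading_block rm rn (merge (pred1 p) v y))
    (leading_block rm rn (merge (pred1 p) v y0)).
rewrite Zy Zy0 subrr !leadE => H.
have {}H : 0 = (y i0 j0 - y0 i0 j0) * \det (row' ord_max (col' ord_max
    (leading_block rm rn (merge (pred1 p) v y0)))).
  apply: H => a b ab; rewrite !mxE /= xpair_eqE wi wj.
  by move: ab; rewrite -negb_and => /negbTE ->.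
apply/eqP; rewrite -subr_eq0; move/esym/eqP: H; rewrite mulf_eq0 => /orP[//|/eqP H].
case: nZy0; rewrite /Z1 /=; rewrite -[RHS]H; congr (\det _);
    apply/matrixP => a b; rewrite !mxE.
have -> : widen_ord (ltnW rm) a = widen_ord rm (lift ord_max a).
  by apply: val_inj; rewrite /= /bump leqNgt ltn_ord.
have -> : widen_ord (ltnW rn) b = widen_ord rn (lift ord_max b).
  by apply: val_inj; rewrite /= /bump leqNgt ltn_ord.
by [].
Qed.

End nonsingular.

Section chi_square.
Context {R : realType} (s : R) (s0 : s != 0) (m n : nat).
Variable mu : probability (mxspace R m n) R.
Hypothesis mug : gaussian_law s mu.

Lemma ge0_integral_merge (J : pred ('I_m * 'I_n)) (F : mxspace R m n -> \bar R) :
  measurable_fun setT F -> (forall v, 0 <= F v)%E ->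
  (\int[mu]_v F v = \int[mu]_v \int[mu]_y F (merge J v y))%E.
Proof.
move=> mF F0; pose f (z : mxspace R m n * mxspace R m n) : mxspace R m n :=
    merge J z.1 z.2.
have mf : measurable_fun setT f by exact: measurable_merge.
have H := @ge0_integral_pushforward _ _ _ _ R _ mf (mu \x mu)%E setT F measurableT
    mF (fun v _ => F0 v).
rewrite preimage_setT in H.
have mFf : measurable_fun setT (F \o f) by exact: measurableT_comp.
rewrite -(fubini_tonelli1 (m1 := mu) (m2 := mu) (F \o f) mFf (fun z => F0 _)).
rewrite -H; apply: eq_measure_integral => E mE _.
apply: (etrans (gaussian_merge mug J mE)); rewrite /pushforward/= /product_measure1/=.
by apply: eq_integral => v _ /=; congr (mu _); apply/seteqP; split => y /=;
    rewrite xsectionE.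
Qed.

Lemma ge0_integral_coord (p : 'I_m * 'I_n) (f : R -> \bar R) :
  measurable_fun setT f -> (forall x, 0 <= f x)%E ->
  (\int[mu]_v f (v p.1 p.2) = \int[gaussR s]_x f x)%E.
Proof.
move=> mf f0.
have mp : measurable_fun setT (fun v : mxspace R m n => v p.1 p.2) by exact:
    measurable_coord.
have H := @ge0_integral_pushforward _ _ _ _ R _ mp mu setT f measurableT mf (fun v
    _ => f0 v).
rewrite preimage_setT in H; rewrite -H.
by apply: eq_measure_integral => E mE _; exact: (gaussian_coord mug).
Qed.

Definition chi2 (K : seq ('I_m * 'I_n)) (v : 'M[R]_(m, n)) : R :=
  \sum_(p <- K) (v p.1 p.2 / s) ^+ 2.

Lemma measurable_chi2 K : measurable_fun setT (chi2 K : mxspace R m n -> R).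
Proof.
apply: measurable_sum => p; apply: measurable_funX.
by apply: measurable_funM => //; exact: measurable_coord.
Qed.

(** By independence, the entries are integrated one at a time. *)
Lemma chi2_mgf (K : seq ('I_m * 'I_n)) (l : R) : uniq K -> - 8^-1 <= l <= 8^-1 ->
  (\int[mu]_v (expR (l * chi2 K v))%:E <= (expR ((size K)%:R * (l + 2 * l ^+
      2)))%:E)%E.
Proof.
move=> + l8; elim: K => [_|p K IH /= /andP[pK uK]].
  under eq_integral do rewrite /chi2 big_nil mulr0 expR0.
  by rewrite integral_cst// mul1e mul0r expR0; exact: probability_le1.
have mE (K' : seq ('I_m * 'I_n)) : measurable_fun setT (fun v :
    mxspace R m n => (expR (l * chi2 K' v))%:E).
  apply/measurable_EFinP; apply: measurableT_comp => //.
  by apply: measurable_funM => //; exact: measurable_chi2.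
have E0 (x : R) : (0 <= (expR x)%:E)%E by rewrite lee_fin expR_ge0.
have mq : measurable_fun setT (fun x : R => (expR (l * (x / s) ^+ 2))%:E).
  apply/measurable_EFinP; apply: measurableT_comp => //.
  by apply: measurable_funM => //; apply: measurable_funX; apply: measurable_funM.
rewrite (ge0_integral_merge (pred1 p))//.
pose c := (\int[gaussR s]_x (expR (l * (x / s) ^+ 2))%:E)%E.
rewrite (_ : (\int[mu]_v _ = \int[mu]_v (c * (expR (l * chi2 K v))%:E))%E);
    last first.
  apply: eq_integral => v _.
  rewrite /c -(ge0_integral_coord p mq)// -ge0_integralZr//; last first.
    exact: (measurableT_comp mq (measurable_coord p.1 p.2)).
  apply: eq_integral => y _; rewrite -EFinM -expRD -mulrDr; congr (expR (l * _))%:E.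
  rewrite /chi2 big_cons !mxE /= -surjective_pairing eqxx; congr (_ + _).
  rewrite !big_seq; apply: eq_bigr => r rK; rewrite mxE /= -surjective_pairing.
  by case: eqP => // rp; move: pK; rewrite -rp rK.
rewrite ge0_integralZl//; last by apply: integral_ge0.
rewrite -natr1 mulrDl mul1r addrC expRD EFinM.
apply: lee_pmul => //; [by apply: integral_ge0|by apply: integral_ge0| |exact: IH].
exact: gaussR_sqr_mgf_le.
Qed.

(** Markov inequality for the exponential of [l * chi2 K]; the sign of [l]
selects the upper or the lower tail. *)
Lemma chi2_tail (K : seq ('I_m * 'I_n)) (l : R) (a : R) : uniq K ->
    - 8^-1 <= l <= 8^-1 ->
  (mu [set v | (l * a <= l * (chi2 K v - (size K)%:R))%R] <=
    (expR (2 * l ^+ 2 * (size K)%:R - l * a)%R)%:E)%E.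
Proof.
move=> uK l8; set E := [set v | _].
have mE : measurable (E : set (mxspace R m n)).
  rewrite (_ : E = (fun v : mxspace R m n => l * (chi2 K v - (size K)%:R)) @^-1`
      `[l * a, +oo[).
    rewrite -[X in measurable X]setTI; apply: measurable_funM => //.
    by apply: measurable_funB => //; exact: measurable_chi2.
  by apply/seteqP; split => v; rewrite /E/= in_itv/= andbT.
have mexp : measurable_fun setT (fun v : mxspace R m n => (expR (l * chi2 K v))%:E).
  apply/measurable_EFinP; apply: measurableT_comp => //.
  by apply: measurable_funM => //; exact: measurable_chi2.
pose c := expR (l * a + l * (size K)%:R).
have c0 : 0 < c by exact: expR_gt0.
have H : (c%:E * mu E <= \int[mu]_v (expR (l * chi2 K v))%:E)%E.
  rewrite (measure_indic _ mE) -ge0_integralZl//; last 2 first.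
  - by apply/measurable_EFinP; exact: measurable_indic.
  - by rewrite lee_fin ltW.
  apply: ge0_le_integral => //.
  - by move=> v _; rewrite -EFinM lee_fin mulr_ge0// ltW.
  - by apply/measurable_EFinP; apply: measurable_funM => //; exact: measurable_indic.
  move=> v _; rewrite -EFinM lee_fin indicE.
  have [|] := boolP (v \in E); rewrite ?mulr0 ?expR_ge0// inE /E /= => h.
  by rewrite mulr1 ler_expR; move: h; rewrite mulrBr lerBrDr.
have {}H := le_trans H (chi2_mgf uK l8).
rewrite (_ : expR (2 * _ * _ - _) = expR ((size K)%:R * (l + 2 * l ^+ 2)) / c);
    last first.
  by rewrite -expRN -expRD; congr expR; ring.
rewrite -(@lee_pmul2l _ c%:E)// -EFinM mulrCA divff ?gt_eqF// mulr1.
exact: H.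
Qed.

End chi_square.

(** * The law of the excess risk *)

Section more_linear_algebra.
Context {R : realType}.

(** With B = G W^-1, the left-hand side is |B^T P g|^2, whereas |B z|^2 = z^T W^-1 z
because B^T B = W^-1. *)
Lemma projected_norm d q (G : 'M[R]_(d + q, d)) : G^T *m G \in unitmx ->
  exists2 P : 'M[R]_(d + q), orthmx P & forall g : 'cV[R]_(d + q),
    sqnorm2 (invmx (G^T *m G) *m G^T *m (P *m g)) =
    ((usubmx g)^T *m invmx (G^T *m G) *m usubmx g) 0 0.
Proof.
move=> uW; set W := G^T *m G in uW *.
have symW : W^T = W by rewrite /W trmx_mul trmxK.
have symV : (invmx W)^T = invmx W by rewrite trmx_inv symW.
pose B := G *m invmx W.
have BT : B^T = invmx W *m G^T by rewrite /B trmx_mul symV.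
have BB : B^T *m B = invmx W by rewrite BT /B !mulmxA -(mulmxA (invmx W)) mulVmx//
    mul1mx.
have uB : B^T *m B \in unitmx by rewrite BB unitmx_inv.
have [P [U [l [oP oU PE UE]]]] := same_singular_values uB.
pose C : 'M[R]_(d + q) := block_mx U^T 0 0 1%:M.
have oC : orthmx C.
  rewrite /orthmx /C tr_block_mx mulmx_block !trmx0 trmx1 trmxK !mul0mx !mulmx0
      !mul1mx.
  by rewrite orthmx_mulVr// !addr0 add0r -scalar_mx_block.
exists (P *m C); first exact: orthmxM.
move=> g; rewrite -BT -mulmxA PE.
have -> : usubmx (C *m g) = U^T *m usubmx g.
  by rewrite -{1}[g]vsubmxK /C mul_block_col mul0mx addr0 col_mxKu.
rewrite -UE (mulmxA U) orthmx_mulVr// mul1mx sqnorm2E trmx_mul mulmxA -(mulmxA _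
    B^T) BB.
by [].
Qed.

Lemma rotated_inverse_form e (W P : 'M[R]_e.+1) (z : 'cV[R]_e.+1) (r : R) :
  orthmx P -> P *m z = r *: delta_mx 0 0 -> W \in unitmx ->
  (z^T *m invmx (P^T *m W *m P) *m z) 0 0 = r ^+ 2 * invmx W 0 0.
Proof.
move=> oP Pz uW.
have uP : P \in unitmx by have [] := mulmx1_unit oP.
have -> : invmx (P^T *m W *m P) = P^T *m invmx W *m P.
  apply: (can_inj (mulKmx (_ : P^T *m W *m P \in unitmx))).
    by rewrite !unitmx_mul unitmx_tr uP uW.
  rewrite mulmxV ?unitmx_mul ?unitmx_tr ?uP ?uW//.
  rewrite !mulmxA -(mulmxA _ P) orthmx_mulVr// mulmx1 -(mulmxA _ W) mulmxV// mulmx1.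
  by rewrite oP.
have -> : z^T *m (P^T *m invmx W *m P) *m z = (P *m z)^T *m invmx W *m (P *m z).
  by rewrite trmx_mul !mulmxA.
have dT : (r *: delta_mx 0 0 : 'cV[R]_e.+1)^T = r *: (delta_mx 0 0 : 'rV[R]_e.+1).
  by rewrite linearZ/= trmx_delta.
rewrite Pz dT -scalemxAr -!scalemxAl scalerA mxE expr2; congr (_ * _).
by rewrite -rowE -colE !mxE.
Qed.

End more_linear_algebra.

Section reduction.
Context {R : realType} (s : R) (s0 : s != 0) (e q k : nat).
Local Notation m := (e.+1 + q)%N.
Local Notation n := (e.+1 + (1 + k))%N.
Local Notation V := (mxspace R m n).
Variable mu : probability V R.
Hypothesis mug : gaussian_law s mu.

(** In the basis adapted to the problem, the first [e.+1] columns of the sketch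
act on the range of [A] and the next one on the residual. *)
Definition design (S : V) : mxspace R m e.+1 := lsubmx S.
Definition response (S : V) : mxspace R m 1 := lsubmx (rsubmx S).
Definition gram (S : V) : mxspace R e.+1 e.+1 := (design S)^T *m design S.
Definition response_top (S : V) : mxspace R e.+1 1 := usubmx (response S).

Lemma measurable_design : measurable_fun setT design.
Proof.
apply: measurable_mx => i j; rewrite /design; under eq_fun do rewrite mxE.
exact: measurable_coord.
Qed.

Lemma measurable_response : measurable_fun setT response.
Proof.
apply: measurable_mx => i j; rewrite /response; under eq_fun do rewrite !mxE.
exact: measurable_coord.
Qed.

Lemma measurable_response_top : measurable_fun setT response_top.
Proof.
apply: measurable_mx => i j; rewrite /response_top /response;
    under eq_fun do rewrite !mxE.
exact: measurable_coord.
Qed.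

Lemma measurable_gram : measurable_fun setT gram.
Proof.
exact: (measurable_mulmx (measurable_trmx measurable_design) measurable_design).
Qed.

(** The excess risk of the sketched solution, normalised by the optimal risk. *)
Definition excess_sketch (S : V) : R := sqnorm2 (invmx (gram S) *m (design S)^T *m
    response S).
Definition excess_quad (S : V) : R :=
  ((response_top S)^T *m invmx (gram S) *m response_top S) 0 0.
Definition excess_axis (S : V) : R := sqnorm2 (response_top S) * invmx (gram S) 0 0.
Definition excess_ratio (S : V) : R :=
  sqnorm2 (response_top S) / (\sum_(i < m | (e <= i)%N) design S i 0 ^+ 2).

Lemma measurable_excess_sketch : measurable_fun setT excess_sketch.
Proof.
apply: (@measurable_sqnorm2 _ _ _ e.+1 (fun S => invmx (gram S) *m (design S)^T *m
    response S)).
have mB := measurable_mulmx (measurable_invmx measurable_gram) (measurable_trmx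
    measurable_design).
exact: (measurable_mulmx mB measurable_response).
Qed.

Lemma measurable_excess_quad : measurable_fun setT excess_quad.
Proof.
apply: (@measurable_mxcomp _ _ _ 1 1 (fun S => (response_top S)^T *m invmx (gram S)
    *m response_top S)).
have mB := measurable_mulmx (measurable_trmx measurable_response_top)
    (measurable_invmx measurable_gram).
exact: (measurable_mulmx mB measurable_response_top).
Qed.

Lemma measurable_excess_axis : measurable_fun setT excess_axis.
Proof.
apply: measurable_funM; first exact: (measurable_sqnorm2 measurable_response_top).
exact: (measurable_mxcomp _ _ (measurable_invmx measurable_gram)).
Qed.

Lemma measurable_excess_ratio : measurable_fun setT excess_ratio.
Proof.
apply: measurable_funM; first exact: (measurable_sqnorm2 measurable_response_top).
apply: measurable_funV.
have -> : (fun S : V => \sum_(i < m | (e <= i)%N) design S i 0 ^+ 2) =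
    (fun S => \sum_(i < m) (if (e <= i)%N then design S i 0 ^+ 2 else 0)).
  by apply/funext => S; rewrite big_mkcond.
apply: measurable_sum => i; case: (e <= i)%N; last exact: measurable_cst.
by apply: measurable_funX; exact: (measurable_mxcomp _ _ measurable_design).
Qed.

(** On singular Gram matrices [invmx] is a default value, so they are kept apart. *)
Definition regular_event (f : V -> R) (D : set R) : set V :=
    [set S | gram S \in unitmx /\ D (f S)].

Lemma measurable_regular_event (f : V -> R) (D : set R) :
    measurable_fun setT f -> measurable D ->
  measurable (regular_event f D).
Proof.
move=> mf mD; apply: measurableI; first exact: (measurable_unitmx measurable_gram).
exact: (measurable_preimage_set mf mD).
Qed.

(** The top square block of the design is almost surely invertible. *)
Lemma gram_singular : mu [set S | gram S \notin unitmx] = 0%E.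
Proof.
apply/eqP; rewrite eq_le measure_ge0 andbT.
rewrite -(gaussian_nonsingular (leq_addr q e.+1) (leq_addr (1 + k) e.+1) mug).
have mdet : measurable_fun setT (fun S : V => \det (leading_block (leq_addr q e.+1)
    (leq_addr (1 + k) e.+1) S)).
  by apply: measurable_det; exact: measurable_leading_block.
apply: le_measure; rewrite ?inE//.
- rewrite (_ : [set S | _] = ~` [set S | gram S \in unitmx]); last first.
    by apply/seteqP; split => S /= /negP.
  by apply: measurableC; exact: (measurable_unitmx measurable_gram).
- exact: (measurable_preimage_set mdet (measurable_set1 0)).
move=> S /=; apply: contraNP => /eqP d0; apply: inj_unitmx => v /gram_eq0.
rewrite -[design S]vsubmxK mul_col_mx => h0.
have h : usubmx (design S) *m v = 0.
  have := congr1 (@usubmx _ _ _ _) h0; rewrite col_mxKu => ->.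
  by apply/matrixP => i j; rewrite !mxE.
apply: (unitmx_mul_eq0 _ h).
rewrite unitmxE unitfE (_ : usubmx _ = leading_block (leq_addr q e.+1) (leq_addr (1
    + k) e.+1) S)//.
apply/matrixP => i j; rewrite !mxE; congr (S _ _); exact: val_inj.
Qed.

Lemma sketch_le_quad D : measurable D -> (mu (regular_event excess_sketch D) <= mu
    (regular_event excess_quad D))%E.
Proof.
move=> mD; pose J : pred ('I_m * 'I_n) := fun ij => ij.2 == rshift e.+1 (lshift k 0).
apply: (measure_le_of_rotation (J := J) mug).
- exact: (measurable_regular_event measurable_excess_sketch mD).
- exact: (measurable_regular_event measurable_excess_quad mD).
move=> v.
have dM y : design (merge J v y) = design v.
  apply/matrixP => i j; rewrite !mxE /J /= -val_eqE /= addn0.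
  by rewrite ltn_eqF// ltn_ord.
have rM y : response (merge J v y) = response y.
  by apply/matrixP => i j; rewrite !mxE /J /= ord1 eqxx.
have gM y : gram (merge J v y) = gram v by rewrite /gram !dM.
have [uW|nuW] := boolP (gram v \in unitmx); last first.
  by exists id; [exact: preserves_id|move=> y []; rewrite gM (negbTE nuW)].
have [P oP PE] := projected_norm uW.
exists (mulmx P); first exact: (preserves_orthl s0 mug).
move=> y; rewrite /regular_event /= /excess_sketch /excess_quad /response_top !gM
    !rM !dM => -[_ DE].
split => //; rewrite -PE; move: DE.
by rewrite (_ : response (P *m y) = P *m response y)// /response -!mulmx_rsub
    -mulmx_lsub.
Qed.

Lemma quad_le_axis D : measurable D -> (mu (regular_event excess_quad D) <= mu
    (regular_event excess_axis D))%E.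
Proof.
move=> mD; pose J : pred ('I_m * 'I_n) := fun ij => (ij.2 < e.+1)%N.
apply: (measure_le_of_rotation (J := J) mug).
- exact: (measurable_regular_event measurable_excess_quad mD).
- exact: (measurable_regular_event measurable_excess_axis mD).
move=> v.
have dM y : design (merge J v y) = design y.
  by apply/matrixP => i j; rewrite !mxE /J /= ltn_ord.
have rM y : response (merge J v y) = response v.
  by apply/matrixP => i j; rewrite !mxE /J /= ltnNge leq_addr.
have gM y : gram (merge J v y) = gram y by rewrite /gram !dM.
have [P oP [r r2 Pz]] := rotate_to_first (response_top v).
pose C : 'M[R]_n := block_mx P 0 0 1%:M.
have oC : orthmx C.
  rewrite /orthmx /C tr_block_mx mulmx_block !trmx0 trmx1 !mul0mx !mulmx0 !mul1mx.
  by rewrite oP !addr0 add0r -scalar_mx_block.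
exists (fun y => y *m C); first exact: (preserves_orthr s0 mug).
move=> y; rewrite /regular_event /= /excess_quad /excess_axis /response_top !gM !rM.
have -> : gram (y *m C) = P^T *m gram y *m P.
  rewrite /gram (_ : design (y *m C) = design y *m P); last first.
    by rewrite /design -{1}[y]hsubmxK /C mul_row_block mulmx0 addr0 row_mxKl.
  by rewrite trmx_mul !mulmxA.
rewrite !unitmx_mul => -[/andP[/andP[_ uW] _] DE]; split => //.
by move: DE; rewrite (rotated_inverse_form oP Pz uW) r2.
Qed.

Lemma axis_le_ratio D : measurable D -> (mu (regular_event excess_axis D) <= mu
    [set S | D (excess_ratio S)])%E.
Proof.
move=> mD; pose J : pred ('I_m * 'I_n) := fun ij => ij.2 == lshift (1 + k) 0.
apply: (measure_le_of_rotation (J := J) mug).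
- exact: (measurable_regular_event measurable_excess_axis mD).
- exact: (measurable_preimage_set measurable_excess_ratio mD).
move=> v.
pose G' : 'M[R]_(m, e) := \matrix_(i, j) design v i (lift 0 j).
have [Q rQ tri] := qr_decomposition G'.
have oQ := rotation_product_orth rQ.
exists (mulmx Q^T); first exact: (preserves_orthl s0 mug (orthmx_tr oQ)).
move=> y [].
have rM w : response (merge J v w) = response v.
  by apply/matrixP => i j; rewrite !mxE /J /=.
rewrite /excess_axis /excess_ratio /response_top !rM.
pose N := Q *m design (merge J v (Q^T *m y)).
have N0 i : N i 0 = design y i 0.
  transitivity ((Q *m (Q^T *m y)) i (lshift (1 + k) 0)).
    rewrite !mxE; apply: eq_bigr => a _; congr (_ * _).
    by rewrite !mxE.
  by rewrite mulmxA orthmx_mulVr// mul1mx mxE.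
have N1 (i : 'I_m) (j : 'I_e) : (e <= i)%N -> N i (lift 0 j) = 0.
  move=> ei; rewrite -[RHS](tri i j (leq_trans (ltn_ord j) ei)) !mxE.
  by apply: eq_bigr => a _; rewrite !mxE /J.
have WN : gram (merge J v (Q^T *m y)) = N^T *m N.
  by rewrite /gram /N trmx_mul mulmxA -(mulmxA _ Q^T) oQ mulmx1.
rewrite WN => uN DE.
have := gram_inv_first (leq_trans (leqnSn e) (leq_addr q e.+1)) N1 uN.
under eq_bigr do rewrite N0.
move=> h.
have c0 : \sum_(i < m | (e <= i)%N) design y i 0 ^+ 2 != 0.
  by apply/eqP => c0; move/eqP: h; rewrite c0 mulr0 eq_sym oner_eq0.
have dE : \sum_(i < m | (e <= i)%N) design (merge J v y) i 0 ^+ 2 =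
          \sum_(i < m | (e <= i)%N) design y i 0 ^+ 2.
  by apply: eq_bigr => i _; rewrite !mxE /J /=.
rewrite /= rM dE; move: DE; congr (D (_ * _)).
by apply: (mulIf c0); rewrite h mulVf.
Qed.

Lemma excess_law D : measurable D ->
  (mu ([set S | gram S \notin unitmx] `|` regular_event excess_sketch D) <= mu [set
      S | D (excess_ratio S)])%E.
Proof.
move=> mD.
have mN : measurable ([set S | gram S \notin unitmx] : set V).
  rewrite (_ : [set S | _] = ~` [set S | gram S \in unitmx]); last first.
    by apply/seteqP; split => S /= /negP.
  by apply: measurableC; exact: (measurable_unitmx measurable_gram).
have mB : measurable (regular_event excess_sketch D) by exact:
    (measurable_regular_event measurable_excess_sketch mD).
apply: (le_trans (measureU2 _ mN mB)).
rewrite [X in (X + _)%E]gram_singular add0e.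
by apply: (le_trans (sketch_le_quad mD)); apply: (le_trans (quad_le_axis mD));
    exact: axis_le_ratio.
Qed.

End reduction.

(** * Concentration *)

Section concentration.
Context {R : realType}.

(** With d at most m / 8, both b and m - d - 1 are at least 3 m / 4. The number
b is close to m - d + 1 instead of m - d - 1, which costs an error 2 d in the
numerator: this is where eps m >= 1 is used. *)
Lemma ratio_close (a b d m eps t : R) :
  1 <= d -> 8 * d <= m -> 0 < t -> t <= 8^-1 -> 4 * t <= eps -> 1 <= eps * m ->
  `|a - d| < t * m -> `|b - (m - d + 1)| < t * m ->
  `|a / b - d / (m - d - 1)| < eps.
Proof.
move=> d1 dm t0 t8 teps em ha hb.
have /andP[a1 a2] : - (t * m) < a - d < t * m by rewrite -ltr_norml.
have /andP[b1 b2] : - (t * m) < b - (m - d + 1) < t * m by rewrite -ltr_norml.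
have m8 : 8 <= m by lra.
have tm : t * m <= m / 8 by rewrite mulrC ler_wpM2l//; lra.
have p0 : 0 < m - d - 1 by lra.
have b0 : 0 < b by lra.
have -> : a / b - d / (m - d - 1) = (a * (m - d - 1) - d * b) / (b * (m - d - 1)).
  by field; rewrite !gt_eqF.
rewrite normrM normfV (ger0_norm (ltW (mulr_gt0 b0 p0))) ltr_pdivrMr ?mulr_gt0//.
rewrite (_ : a * (m - d - 1) - d * b = (a - d) * (m - d - 1) - d * (b - (m - d +
    1)) - 2 * d); last by ring.
have bb : m * 3 / 4 <= b by lra.
have pp : m * 3 / 4 <= m - d - 1 by lra.
have bp : (m * 3 / 4) * (m * 3 / 4) <= b * (m - d - 1) by apply: ler_pM => //; lra.
apply: (@lt_le_trans _ _ (eps * ((m * 3 / 4) * (m * 3 / 4)))); last first.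
  by rewrite ler_wpM2l//; lra.
have h1 : `|(a - d) * (m - d - 1)| <= t * m * m.
  rewrite normrM; apply: ler_pM => //; first exact: ltW.
  by rewrite ger0_norm; lra.
have h2 : `|d * (b - (m - d + 1))| <= m / 8 * (t * m).
  rewrite normrM; apply: ler_pM => //; first by rewrite ger0_norm; lra.
  exact: ltW.
have h3 : `|2 * d| <= m / 4 by rewrite ger0_norm; lra.
apply: (@le_lt_trans _ _ (t * m * m + m / 8 * (t * m) + m / 4)).
  apply: (le_trans (ler_normB _ _)); apply: lerD => //.
  by apply: (le_trans (ler_normB _ _)); apply: lerD.
have h4 : t * m * m <= eps / 4 * m * m by rewrite !ler_wpM2r//; lra.
have h5 : m <= eps * m * m by rewrite ler_peMl//; lra.
have h6 : 0 < eps * m * m by rewrite !mulr_gt0//; lra.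
have -> : eps * (m * 3 / 4 * (m * 3 / 4)) = 9 / 16 * (eps * m * m) by field.
have -> : m / 8 * (t * m) = 8^-1 * (t * m * m) by field.
have e4 : eps / 4 * m * m = 4^-1 * (eps * m * m) by field.
rewrite e4 in h4; lra.
Qed.

Lemma chi2_concentration m n (mu : probability (mxspace R m n) R) (s : R)
    (K : seq ('I_m * 'I_n)) (t M : R) : s != 0 -> gaussian_law s mu ->
  uniq K -> (size K)%:R <= M -> 0 < t -> t <= 8^-1 ->
  (mu [set v | (t * M <= `|chi2 s K v - (size K)%:R|)%R] <=
    (2 * expR (- (t ^+ 2 * M / 8)))%:E)%E.
Proof.
move=> s0 mug uK KM t0 t8.
have M0 : 0 <= M := le_trans (ler0n _ _) KM.
pose X v := chi2 s K v - (size K)%:R.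
have mX : measurable_fun setT (X : mxspace R m n -> R).
  by apply: measurable_funB => //; exact: measurable_chi2.
pose E (l a : R) : set (mxspace R m n) := [set v | l * a <= l * X v].
have mE l a : measurable (E l a).
  rewrite (_ : E l a = (fun v : mxspace R m n => l * X v) @^-1` `[l * a, +oo[).
    by rewrite -[X in measurable X]setTI; apply: measurable_funM.
  by apply/seteqP; split => v; rewrite /E/= in_itv/= andbT.
have sub : [set v | t * M <= `|X v|] `<=` E (t / 4) (t * M) `|` E (- (t / 4)) (- (t
    * M)).
  move=> v /=; rewrite lter_normr => /orP[h|h]; [left|right]; rewrite /E /=.
    by rewrite ler_wpM2l//; lra.
  by rewrite !mulNr mulrN opprK -mulrN ler_wpM2l//; lra.
have mS : measurable ([set v | t * M <= `|X v|] : set (mxspace R m n)).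
  rewrite (_ : [set v | _] = (fun v : mxspace R m n => `|X v|) @^-1` `[t * M, +oo[).
    by rewrite -[X in measurable X]setTI; apply: measurableT_comp.
  by apply/seteqP; split => v; rewrite /= in_itv/= andbT.
apply: (@le_trans _ _ (mu (E (t / 4) (t * M) `|` E (- (t / 4)) (- (t * M))))).
  by apply: le_measure; rewrite ?inE//; exact: measurableU.
apply: (le_trans (measureU2 _ (mE _ _) (mE _ _))).
(* [l = t / 4] and [l = - (t / 4)] minimise [2 * l ^+ 2 * M - l * a] for
   [a = t * M] and [a = - (t * M)]. *)
have bound (l a : R) : l ^+ 2 = t ^+ 2 / 16 -> l * a = t ^+ 2 * M / 4 ->
    - 8^-1 <= l <= 8^-1 ->
    (mu (E l a) <= (expR (- (t ^+ 2 * M / 8)))%:E)%E.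
  move=> l2 la l8; apply: (le_trans (chi2_tail s0 mug a uK l8)).
  rewrite lee_fin ler_expR l2 la.
  have : t ^+ 2 / 16 * (size K)%:R <= t ^+ 2 / 16 * M.
    by rewrite ler_wpM2l// divr_ge0// sqr_ge0.
  by lra.
rewrite mulr_natl mulr2n EFinD; apply: leeD; apply: bound.
- by field.
- by field.
- by apply/andP; split; lra.
- by field.
- by field.
- by apply/andP; split; lra.
Qed.

Section sketch_law.
Context disp (T : measurableType disp) (P : probability T R) (m n : nat).
Variable S : 'I_m -> 'I_n -> {RV P >-> R}.
Hypothesis Sg : gaussian_sketch S.

Lemma measurable_rvmx : measurable_fun setT (rvmx S : T -> mxspace R m n).
Proof. apply: measurable_mx => i j; rewrite /rvmx; under eq_fun do rewrite mxE.
exact: measurable_funPT. Qed.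

(** Mutual independence, used with all entries, is the product formula on
boxes. *)
Lemma sketch_gaussian_law : exists2 mu : probability (mxspace R m n) R,
  gaussian_law (Num.sqrt m%:R^-1) mu &
  forall E : set (mxspace R m n), mu E = P [set t | E (rvmx S t)].
Proof.
pose F : {mfun T >-> mxspace R m n} :=
  HB.pack (rvmx S : T -> mxspace R m n) (isMeasurableFun.Build _ _ _ _ _
      measurable_rvmx).
exists (distribution P F) => // B mB; have [SD SI] := Sg.
have := SI [set: 'I_m * 'I_n]%SET B mB.
rewrite [X in _ = X](_ : _ = \prod_(p : 'I_m * 'I_n) gaussR (Num.sqrt m%:R^-1) (B
    p))%E; last first.
  by apply: eq_big => [p|p _]; [rewrite inE|exact: SD].
move=> <-; rewrite /distribution /pushforward; congr (P _).
apply/seteqP; split => t /= h.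
  by move=> p _; have := h p; rewrite mxE.
by move=> p; rewrite mxE; apply: h; rewrite inE.
Qed.

End sketch_law.

Lemma excess_ratio_tail e q k (mu : probability (mxspace R (e.+1 + q) (e.+1 + (1 +
    k))) R) (eps t : R) :
  let m := (e.+1 + q)%N in let d := e.+1 in
  gaussian_law (Num.sqrt m%:R^-1) mu ->
  8 * d%:R <= m%:R :> R -> 0 < t -> t <= 8^-1 -> 4 * t <= eps -> 1 <= eps * m%:R ->
  (mu [set S | (eps <= `|excess_ratio S - d%:R / (m%:R - d%:R - 1)|)%R] <=
    (4 * expR (- (t ^+ 2 * m%:R / 8)))%:E)%E.
Proof.
move=> m d mug dm t0 t8 teps em.
set s := Num.sqrt _ in mug.
have m0 : 0 < m%:R :> R by rewrite ltr0n.
have s0 : s != 0 by rewrite gt_eqF// sqrtr_gt0 invr_gt0.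
pose n := (e.+1 + (1 + k))%N.
pose j0 : 'I_n := lshift (1 + k) ord0.
pose jd : 'I_n := rshift e.+1 (lshift k ord0).
pose K1 : seq ('I_m * 'I_n) := [seq (lshift q i, jd) | i <- enum 'I_e.+1].
pose K2 : seq ('I_m * 'I_n) := [seq (i, j0) | i <- [seq i <- enum 'I_m | (e <= val
    i)%N]].
have u1 : uniq K1.
  by rewrite map_inj_uniq ?enum_uniq// => i j [] ij; exact: val_inj.
have u2 : uniq K2.
  rewrite map_inj_uniq; first by apply: filter_uniq; exact: enum_uniq.
  by move=> i j /(congr1 fst).
have z1 : size K1 = e.+1 by rewrite size_map size_enum_ord.
have z2 : size K2 = q.+1.
  rewrite size_map size_filter -(count_map val (leq e)) val_enum_ord.
  rewrite (_ : m = (e + q.+1)%N) ?iotaD ?count_cat ?add0n; last by rewrite /m addnS.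
  rewrite (@eq_in_count _ (leq e) pred0 (iota 0 e)); last first.
    by move=> i; rewrite mem_iota add0n /= => ie; rewrite leqNgt ie.
  rewrite (@eq_in_count _ (leq e) predT (iota e q.+1)); last first.
    by move=> i; rewrite mem_iota => /andP[].
  by rewrite count_pred0 count_predT size_iota.
have c1 S : sqnorm2 (response_top S) = s ^+ 2 * chi2 s K1 S.
  rewrite /sqnorm2 /chi2 big_map big_enum/= mulr_sumr; apply: eq_bigr => i _.
  rewrite !mxE expr_div_n mulrC divfK ?sqrf_eq0//; congr (S _ _ ^+ 2); exact: val_inj.
have c2 S : \sum_(i < m | (e <= i)%N) design S i 0 ^+ 2 = s ^+ 2 * chi2 s K2 S.
  rewrite /chi2 big_map big_filter big_enum_cond/= mulr_sumr; apply: eq_bigr => i _.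
  by rewrite !mxE expr_div_n mulrC divfK ?sqrf_eq0//.
have xE S : excess_ratio S = chi2 s K1 S / chi2 s K2 S.
  by rewrite /excess_ratio c1 c2 invfM mulrACA divff ?mul1r// sqrf_eq0.
have z2R : (size K2)%:R = m%:R - d%:R + 1 :> R.
  by rewrite z2 /m /d natrD -!natr1; ring.
have d1 : 1 <= d%:R :> R by rewrite ler1n.
pose E1 : set (mxspace R m n) := [set S | t * m%:R <= `|chi2 s K1 S - (size K1)%:R|].
pose E2 : set (mxspace R m n) := [set S | t * m%:R <= `|chi2 s K2 S - (size K2)%:R|].
have mE (K : seq ('I_m * 'I_n)) :
    measurable ([set S | t * m%:R <= `|chi2 s K S - (size K)%:R|] :
        set (mxspace R m n)).
  rewrite (_ : [set S | _] = (fun S : mxspace R m n => `|chi2 s K S - (size K)%:R|)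
      @^-1` `[t * m%:R, +oo[).
    rewrite -[X in measurable X]setTI; apply: measurableT_comp => //.
    by apply: measurable_funB => //; exact: measurable_chi2.
  by apply/seteqP; split => v; rewrite /= in_itv/= andbT.
have mE4 : measurable ([set S | eps <= `|excess_ratio S - d%:R / (m%:R - d%:R -
    1)|] : set (mxspace R m n)).
  rewrite (_ : [set S | _] = (fun S : mxspace R m n => `|excess_ratio S - d%:R /
      (m%:R - d%:R - 1)|) @^-1` `[eps, +oo[).
    rewrite -[X in measurable X]setTI; apply: measurableT_comp => //.
    by apply: measurable_funB => //; exact: measurable_excess_ratio.
  by apply/seteqP; split => v; rewrite /= in_itv/= andbT.
apply: (@le_trans _ _ (mu (E1 `|` E2))).
  apply: le_measure; rewrite ?inE//; first by apply: measurableU; exact: mE.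
  move=> S /=; apply: contraPP => /not_orP[]; rewrite /E1 /E2 /= => /negP h1 /negP h2.
  move: h1 h2; rewrite -!ltNge z1 z2R => h1 h2.
  by apply/negP; rewrite -ltNge xE; exact: (ratio_close d1 dm t0 t8 teps em).
apply: (le_trans (measureU2 _ (mE _) (mE _))).
rewrite (_ : 4 * _ = 2 * expR (- (t ^+ 2 * m%:R / 8)) + 2 * expR (- (t ^+ 2 * m%:R
    / 8))); last by ring.
rewrite EFinD; apply: leeD; apply: (chi2_concentration s0 mug) => //.
- by rewrite z1 -/d; lra.
- by rewrite z2R; lra.
Qed.

End concentration.

(** * The tail bound *)

Section tail_bound.
Context {R : realType}.

Lemma sketch_tail (n d m : nat) (A : 'M[R]_(n, d)) (b : 'cV[R]_n) (xstar : 'cV[R]_d)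
    disp (T : measurableType disp) (P : probability T R)
    (S : 'I_m -> 'I_n -> {RV P >-> R}) (xhat : 'I_d -> {RV P >-> R}) (eps t : R) :
  (0 < d)%N ->
  argmin (lsq A b) = [set xstar] -> lsq A b xstar != 0 -> gaussian_sketch S ->
  {ae P, forall w, argmin (lsq (rvmx S w *m A) (rvmx S w *m b)) (\col_(j < d) xhat
      j w)} ->
  8 * d%:R <= m%:R :> R -> 0 < t -> t <= 8^-1 -> 4 * t <= eps -> 1 <= eps * m%:R ->
  ((1 - 4 * expR (- (t ^+ 2 * m%:R / 8)))%:E <=
    P [set w | (`| lsq A b (\col_(j < d) xhat j w) / lsq A b xstar
                   - 1 - d%:R / (m%:R - d%:R - 1) | < eps)%R])%E.
Proof.
case: d A xstar xhat => // e A xstar xhat _ xmin r0 Sg aexhat dm t0 t8 teps em.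
have := overdetermined xmin r0.
move=> /subnKC nE.
pose k := (n - e.+2)%N; rewrite -/k in nE.
have {}nE : n = (e.+1 + (1 + k))%N by rewrite -nE addnA addn1.
have mE : m = (e.+1 + (m - e.+1))%N.
  rewrite subnKC// -(@ler_nat R); apply: le_trans dm.
  by rewrite ler_peMl// ler1n.
(* The sizes are written as sums, so that matrices can be split in blocks. *)
move: (m - e.+1)%N mE => q mE; move: k nE => k nE.
subst n m.
have [mu mug muE] := sketch_gaussian_law Sg.
have [Q oQ [M uM [rho [QA Qr]]]] := least_squares_normal_form xmin.
set m := (e.+1 + q)%N in S Sg aexhat dm em mu mug muE *.
set n := (e.+1 + (1 + k))%N in A b xmin r0 S Sg aexhat mu mug muE Q oQ QA Qr *.
have s0 : Num.sqrt (m%:R^-1 : R) != 0.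
  by rewrite gt_eqF// sqrtr_gt0 invr_gt0 ltr0n.
pose tau : R := e.+1%:R / (m%:R - e.+1%:R - 1).
pose D : set R := [set x | eps <= `|x - tau|].
have mD : measurable D.
  rewrite (_ : D = (fun x => `|x - tau|) @^-1` `[eps, +oo[).
    rewrite -[X in measurable X]setTI; apply: measurableT_comp => //.
    exact: measurable_funB.
  by apply/seteqP; split => v; rewrite /D/= in_itv/= andbT.
pose G : set (mxspace R m n) := [set V | gram V \notin unitmx] `|` regular_event
    (@excess_sketch R e q k) D.
have mN : measurable ([set V | gram V \notin unitmx] : set (mxspace R m n)).
  rewrite (_ : [set V | _] = ~` [set V | gram V \in unitmx]); last first.
    by apply/seteqP; split => V /= /negP.
  by apply: measurableC; exact: (measurable_unitmx (@measurable_gram R e q k)).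
have mG : measurable G.
  by apply: measurableU => //; exact: (measurable_regular_event
      (@measurable_excess_sketch R e q k) mD).
have muG : (mu G <= (4 * expR (- (t ^+ 2 * m%:R / 8)))%:E)%E.
  apply: (le_trans (excess_law s0 mug mD)).
  exact: (excess_ratio_tail mug dm t0 t8 teps em).
have PG : P [set w | G (rvmx S w *m Q^T)] = mu G.
  have [_ pQ] := preserves_orthr s0 mug (orthmx_tr oQ).
  by rewrite -(pQ G mG) muE.
pose f (w : T) : R := `| lsq A b (\col_(j < e.+1) xhat j w) / lsq A b xstar - 1 -
    tau |.
have mf : measurable_fun setT f.
  apply: measurableT_comp => //; apply: measurable_funB => //;
      apply: measurable_funB => //.
  apply: measurable_funM => //.
  apply: (@measurable_sqnorm2 _ _ _ n (fun w => A *m (\col_(j < e.+1) xhat j w) - b)).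
  apply: measurable_mx => i j; under eq_fun do rewrite !mxE.
  apply: measurable_funB => //; apply: measurable_sum => a;
      apply: measurable_funM => //.
  by under eq_fun do rewrite mxE; exact: measurable_funPT.
pose good : set T := [set w | f w < eps].
have mgood : measurable good.
  rewrite (_ : good = f @^-1` `]-oo, eps[).
    by rewrite -[X in measurable X]setTI; exact: mf.
  by apply/seteqP; split => w; rewrite /good/= in_itv.
have [N [mN' PN Nsub]] := aexhat.
have mPG : measurable [set w | G (rvmx S w *m Q^T)].
  have mr := measurable_rvmx S; have mq := @measurable_mulmxr R m n n Q^T.
  exact: (measurable_preimage_set (measurableT_comp mq mr) mG).
have sub : ~` good `<=` N `|` [set w | G (rvmx S w *m Q^T)].
  move=> w; rewrite /good /= => /negP; rewrite -leNgt => bw.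
  have [Nw|nNw] := pselect (N w); [by left|right].
  have hw : argmin (lsq (rvmx S w *m A) (rvmx S w *m b)) (\col_(j < e.+1) xhat j w).
    by apply: contrapT => h; apply: nNw; exact: Nsub.
  have [uW|nuW] := boolP (gram (rvmx S w *m Q^T : mxspace R m n) \in unitmx);
      last by left.
  right; split => //; rewrite /D/= /excess_sketch.
  by have := sketched_ratio oQ uM r0 QA Qr hw uW; rewrite -/(f w) => <-.
have Pbad : (P (~` good) <= (4 * expR (- (t ^+ 2 * m%:R / 8)))%:E)%E.
  apply: (@le_trans _ _ (P (N `|` [set w | G (rvmx S w *m Q^T)]))).
    by apply: le_measure; rewrite ?inE//; [exact: measurableC|exact: measurableU].
  apply: (le_trans (measureU2 _ mN' mPG)).
  by rewrite [X in (X + _)%E]PN add0e [X in (X <= _)%E]PG.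
rewrite (_ : [set w | _] = good)// -[good]setCK probability_setC ?EFinB;
    last exact: measurableC.
exact: leeB.
Qed.

End tail_bound.

Theorem mainTheorem3 (R : realType) :
  exists2 c : R, 0 < c &
  forall epsmax : R, 0 < epsmax ->
  exists C1 C2 : R, [/\ 0 < C1, 0 < C2 &
  forall (n d m : nat) (A : 'M[R]_(n, d)) (b : 'cV[R]_n) (xstar : 'cV[R]_d)
    (disp : measure_display) (T : measurableType disp) (P : probability T R)
    (S : 'I_m -> 'I_n -> {RV P >-> R}) (xhat : 'I_d -> {RV P >-> R}) (eps : R),
  argmin (lsq A b) = [set xstar] ->
  lsq A b xstar != 0 ->
  gaussian_sketch S ->
  {ae P, forall t, argmin (lsq (rvmx S t *m A) (rvmx S t *m b))
                          (\col_(j < d) xhat j t)} ->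
  c * d%:R <= m%:R ->
  0 < eps <= epsmax ->
  ((1 - C1 * expR (- C2 * eps ^+ 4 * m%:R))%:E <=
    P [set t | (`| lsq A b (\col_(j < d) xhat j t) / lsq A b xstar
                   - 1 - d%:R / (m%:R - d%:R - 1) | < eps)%R])%E].
Proof.
exists 8 => // epsmax em0.
(* The Chernoff bounds are used at the level [kap * eps], which is at most 1 / 8
   and at most [eps / 4]. *)
pose kap : R := (4 + 8 * epsmax)^-1.
have kap0 : 0 < kap by rewrite invr_gt0; lra.
pose C2 := kap ^+ 2 / (8 * epsmax ^+ 2).
have C20 : 0 < C2 by rewrite divr_gt0 ?exprn_gt0// mulr_gt0// exprn_gt0.
pose C1 := 4 + expR (C2 * epsmax ^+ 3).
exists C1, C2; split => //; first by rewrite addr_gt0// expR_gt0.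
move=> n d m A b xstar disp T P S xhat eps xmin r0 Sg aexhat dm /andP[eps0 epsm].
have e0 : 0 < expR (- C2 * eps ^+ 4 * m%:R) by exact: expR_gt0.
have [d0|d0] := posnP d.
  subst d; rewrite (_ : [set t | _] = setT).
    rewrite probability_setT lee_fin lerBlDr lerDl mulr_ge0 ?(ltW e0)//.
    by rewrite addr_ge0// expR_ge0.
  apply/seteqP; split => // w _ /=.
  rewrite (_ : \col_(j < 0) _ = xstar); last by apply/matrixP => -[].
  by rewrite divff// subrr mul0r subrr normr0.
(* If [eps * m < 1], then [eps ^+ 4 * m <= epsmax ^+ 3] and the left-hand side is
   not positive by the choice of [C1]. *)
have [em|em] := ltP (eps * m%:R) 1.
  apply: (@le_trans _ _ 0%E); last exact: measure_ge0.
  rewrite lee_fin subr_le0.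
  have h : 1 <= expR (C2 * epsmax ^+ 3) * expR (- C2 * eps ^+ 4 * m%:R).
    rewrite -expRD -[leLHS]expR0 ler_expR.
    rewrite (_ : _ + _ = C2 * (epsmax ^+ 3 - eps ^+ 3 * (eps * m%:R))); last by ring.
    rewrite mulr_ge0 ?(ltW C20)// subr_ge0.
    apply: (@le_trans _ _ (eps ^+ 3)).
      by rewrite ler_piMr ?exprn_ge0 ?(ltW eps0)// ltW.
    by rewrite lerXn2r ?nnegrE ?(ltW eps0) ?(ltW em0).
  by rewrite /C1 mulrDl; apply: (le_trans h); rewrite lerDr mulr_ge0// ltW.
have kE : kap * (4 + 8 * epsmax) = 1 by rewrite mulVf// gt_eqF//; lra.
have t0 : 0 < kap * eps by rewrite mulr_gt0.
have keps : kap * eps <= kap * epsmax by rewrite ler_pM2l.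
have kem : 0 < kap * epsmax by rewrite mulr_gt0.
have t8 : kap * eps <= 8^-1 by move: kE; rewrite mulrDr; lra.
have teps : 4 * (kap * eps) <= eps.
  rewrite mulrA ler_piMl ?(ltW eps0)//; move: kE; rewrite mulrDr; lra.
apply: le_trans (sketch_tail d0 xmin r0 Sg aexhat dm t0 t8 teps em).
rewrite lee_fin lerB//; apply: (@le_trans _ _ (4 * expR (- C2 * eps ^+ 4 * m%:R)));
    last first.
  by rewrite ler_pM2r// /C1 lerDl expR_ge0.
rewrite ler_pM2l// ler_expR !mulNr lerN2.
rewrite (_ : (kap * eps) ^+ 2 * m%:R / 8 = (kap ^+ 2 / (8 * epsmax ^+ 2)) * (epsmax
    ^+ 2 * eps ^+ 2) * m%:R); last first.
  by field; rewrite gt_eqF.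
rewrite ler_wpM2r//; rewrite ler_pM2l// (_ : eps ^+ 4 = eps ^+ 2 * eps ^+ 2);
    last by rewrite -exprD.
by rewrite ler_wpM2r ?sqr_ge0// lerXn2r ?nnegrE ?(ltW eps0) ?(ltW em0).
Qed.
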